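(* If $m\ge1$ is a positive integer, then $\mathcal{P}(^m\ell_1;\ell_2)=\mathcal{P}_{FSt,1}(^m\ell_1;\ell_2)$; that is, every continuous $m$-homogeneous polynomial from $\ell_1$ to $\ell_2$ is factorable strongly $1$-summing.
   Context: Scalars $\mathbb{K}=\mathbb{R}$ or $\mathbb{C}$. For Banach spaces $X,Y$, $\mathcal{P}(^mX;Y)$ is the space of continuous $m$-homogeneous polynomials from $X$ to $Y$, and $\mathcal{P}(^mX)=\mathcal{P}(^mX;\mathbb{K})$ with the sup norm on the unit ball of $X$. For $1\le p<\infty$, $\mathcal{P}_{FSt,p}(^mX;Y)$ (factorable strongly $p$-summing polynomials) consists of those $P\in\mathcal{P}(^mX;Y)$ for which there is $C\ge0$ such that for all positive integers $m_1,m_2$, all $x_j^i\in X$ and all scalars $\lambda_j^i$ ($1\le j\le m_1$, $1\le i\le m_2$), $$\left(\sum_{j=1}^{m_1}\Big\|\sum_{i=1}^{m_2}\lambda_j^iP(x_j^i)\Big\|^p\right)^{1/p}\le C\sup_{q\in\mathcal{P}(^mX),\,\|q\|\le1}\left(\sum_{j=1}^{m_1}\Big|\sum_{i=1}^{m_2}\lambda_j^iq(x_j^i)\Big|^p\right)^{1/p}.$$ *)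

(* Defs.v *)
From mathcomp Require Import ssreflect ssrfun ssrbool eqtype ssrnat fintype.
From Stdlib Require Import Reals Lra ProofIrrelevance FunctionalExtensionality.
From Coquelicot Require Import Coquelicot.

Set Implicit Arguments.
Unset Strict Implicit.
Unset Printing Implicit Defensive.

Local Open Scope R_scope.

(** Stdlib's [Rpower 0 p] is [1] (because [ln 0 = 0]); [rpow] agrees with
    [Rpower] on positive bases and satisfies [rpow 0 p = 0]. *)
Definition rpow (x p : R) : R :=
  match Rlt_dec 0 x with left _ => Rpower x p | right _ => 0 end.

Section RpowTheory.

Lemma rpow_pos x p : 0 < x -> rpow x p = Rpower x p.
Proof. by rewrite /rpow => h; case: (Rlt_dec 0 x). Qed.

Lemma rpow_npos x p : x <= 0 -> rpow x p = 0.
Proof. by rewrite /rpow => h; case: (Rlt_dec 0 x) => // h1; lra. Qed.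

Lemma rpow_gt0 x p : 0 < x -> 0 < rpow x p.
Proof. by move=> x0; rewrite rpow_pos //; apply: exp_pos. Qed.

Lemma rpow_ge0 x p : 0 <= rpow x p.
Proof.
rewrite /rpow; case: (Rlt_dec 0 x) => _; last lra.
exact/Rlt_le/exp_pos.
Qed.

Lemma rpow_le x y p : 0 < p -> x <= y -> rpow x p <= rpow y p.
Proof.
move=> p0 xy; case: (Rlt_dec 0 x) => x0.
  by rewrite !rpow_pos; [apply: Rle_Rpower_l; lra|lra|lra].
by rewrite (@rpow_npos x); [exact: rpow_ge0|lra].
Qed.

Lemma rpowM x y p : 0 <= x -> 0 <= y -> rpow (x * y) p = rpow x p * rpow y p.
Proof.
move=> x0 y0.
case: (Req_dec x 0) => [->|xn].
  by rewrite Rmult_0_l !(@rpow_npos 0); lra.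
case: (Req_dec y 0) => [->|yn].
  by rewrite Rmult_0_r !(@rpow_npos 0); lra.
rewrite !rpow_pos ?Rpower_mult_distr; try lra.
by apply: Rmult_lt_0_compat; lra.
Qed.

Lemma rpowK x p q : p * q = 1 -> 0 <= x -> rpow (rpow x p) q = x.
Proof.
move=> pq x0; case: (Req_dec x 0) => [->|xn].
  by rewrite !rpow_npos //; lra.
rewrite (@rpow_pos (rpow _ _)); last by apply: rpow_gt0; lra.
by rewrite rpow_pos; [rewrite Rpower_mult pq Rpower_1; lra|lra].
Qed.

Lemma rpow_amgm t w : 0 <= t <= 1 -> 0 < w -> Rpower w t <= t * w + (1 - t).
Proof.
move=> t01 w0; set M := _ + _.
have M0 : 0 < M by rewrite /M; nra.
have ln_le z : 0 < z -> ln z <= z - 1.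
  by move=> z0; have := exp_ineq1_le (ln z); rewrite exp_ln //; lra.
have hw := ln_le (w / M) (Rdiv_lt_0_compat _ _ w0 M0).
have h1 := ln_le (/ M) (Rinv_0_lt_compat _ M0).
rewrite ln_div // in hw; rewrite ln_Rinv // in h1.
have e : t * (w / M) + (1 - t) * / M = 1 by rewrite /M; field; rewrite -/M; lra.
have h : t * ln w <= ln M by nra.
rewrite -(exp_ln M) // /Rpower.
by case: h => h; [apply/Rlt_le/exp_increasing|rewrite h; lra].
Qed.

Lemma rpow_tangent s p : 1 <= p -> 0 <= s -> 1 + p * (s - 1) <= rpow s p.
Proof.
move=> p1 s0; set w := _ + _.
case: (Rle_dec w 0) => w0; first by have := rpow_ge0 s p; lra.
have ip : 0 <= / p <= 1.
  split; first by apply/Rlt_le/Rinv_0_lt_compat; lra.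
  by rewrite -Rinv_1; apply: Rinv_le_contravar; lra.
have h := @rpow_amgm _ w ip ltac:(lra).
have e : / p * w + (1 - / p) = s by rewrite /w; field; lra.
rewrite e in h.
rewrite -{1}(@rpowK w (/ p) p); [|by field; lra|lra].
apply: rpow_le; first lra.
by rewrite rpow_pos; lra.
Qed.

Lemma rpow_convex a b t p : 1 <= p -> 0 <= a -> 0 <= b -> 0 <= t <= 1 ->
  rpow (t * a + (1 - t) * b) p <= t * rpow a p + (1 - t) * rpow b p.
Proof.
move=> p1 a0 b0 t01; set M := _ + _.
have M0 : 0 <= M by rewrite /M; nra.
have pa := rpow_ge0 a p; have pb := rpow_ge0 b p.
case: (Req_dec M 0) => [->|Mn]; first by rewrite rpow_npos; nra.
have scale z : 0 <= z -> rpow M p * (1 + p * (z / M - 1)) <= rpow z p.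
  move=> z0; have zM : 0 <= z / M by apply: Rdiv_le_0_compat; lra.
  have {2}-> : z = M * (z / M) by field.
  rewrite rpowM //; apply: Rmult_le_compat_l; first exact: rpow_ge0.
  exact: rpow_tangent.
have ha := scale _ a0; have hb := scale _ b0.
have e : t * (rpow M p * (1 + p * (a / M - 1)))
  + (1 - t) * (rpow M p * (1 + p * (b / M - 1))) = rpow M p.
  suff -> : t * (rpow M p * (1 + p * (a / M - 1)))
    + (1 - t) * (rpow M p * (1 + p * (b / M - 1)))
    = rpow M p * (1 + p * ((t * a + (1 - t) * b) / M - 1)).
    by rewrite -/M; field.
  by field.
by nra.
Qed.

End RpowTheory.

Section Lp.

Variables (K : AbsRing) (p : R) (hp : 1 <= p).

Record lp : Type := Lp {
  lp_seq :> nat -> K;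
  lp_summable : ex_series (fun n => rpow (abs (lp_seq n)) p) }.

Definition lp_norm (x : lp) : R :=
  rpow (Series (fun n => rpow (abs (x n)) p)) (/ p).

Lemma lp_ext (x y : lp) : (forall n, x n = y n) -> x = y.
Proof.
case: x y => [x hx] [y hy] /= /functional_extensionality xy.
by subst y; rewrite (proof_irrelevance _ hx hy).
Qed.

Let p0 : 0 < p. Proof. lra. Qed.

Let ip0 : 0 < / p. Proof. exact: Rinv_0_lt_compat. Qed.

Let pK : p * / p = 1. Proof. by field; lra. Qed.

Let Kp : / p * p = 1. Proof. by field; lra. Qed.

Lemma rpow_abs_plus (a b : R) (u v : K) : 0 < a -> 0 < b ->
  rpow (abs (plus u v)) p <=
    rpow (a + b) p * (a / (a + b) * / rpow a p) * rpow (abs u) p +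
    rpow (a + b) p * (b / (a + b) * / rpow b p) * rpow (abs v) p.
Proof.
move=> a0 b0.
have ab : 0 < a + b by lra.
have ra := @rpow_gt0 a p a0; have rb := @rpow_gt0 b p b0.
have key z c : 0 <= z -> 0 < c -> rpow (z / c) p = rpow z p * / rpow c p.
  move=> z0 c0; have ic := Rinv_0_lt_compat _ c0.
  rewrite /Rdiv rpowM //; last lra.
  have e : rpow c p * rpow (/ c) p = 1.
    rewrite -rpowM; [|lra|lra]; rewrite Rinv_r; last lra.
    by rewrite rpow_pos /Rpower ?ln_1 ?Rmult_0_r ?exp_0; lra.
  congr (_ * _); have rc := @rpow_gt0 c p c0.
  by apply: (Rmult_eq_reg_l (rpow c p)); rewrite ?e ?Rinv_r; lra.
set t := a / (a + b).
have t01 : 0 <= t <= 1.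
  split; first by apply: Rdiv_le_0_compat; lra.
  by apply: (Rmult_le_reg_r (a + b)) => //; rewrite /t; field_simplify; lra.
have tb : b / (a + b) = 1 - t by rewrite /t; field; lra.
have au := abs_ge_0 u; have av := abs_ge_0 v.
have ua : 0 <= abs u / a by apply: Rdiv_le_0_compat; lra.
have vb : 0 <= abs v / b by apply: Rdiv_le_0_compat; lra.
have c := @rpow_convex _ _ t p hp ua vb t01.
have h1 : rpow (abs (plus u v)) p <=
    rpow ((a + b) * (t * (abs u / a) + (1 - t) * (abs v / b))) p.
  apply: rpow_le => //; apply: Rle_trans (abs_triangle _ _) _.
  by right; rewrite /t; field; lra.
apply: Rle_trans h1 _.
rewrite rpowM; [|lra|nra].
rewrite !key // in c.
rewrite tb.
have r := @rpow_ge0 (a + b) p.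
apply: Rle_trans (Rmult_le_compat_l _ _ _ r c) _.
by right; ring.
Qed.

Lemma lp_plus_summable (x y : lp) :
  ex_series (fun n => rpow (abs (plus (x n) (y n))) p).
Proof.
pose c := rpow (1 + 1) p * (1 / (1 + 1) * / rpow 1 p).
apply: (@ex_series_le R_AbsRing R_CompleteNormedModule _
  (fun n => c * rpow (abs (x n)) p + c * rpow (abs (y n)) p)).
  move=> n; rewrite /norm /= /abs /= Rabs_pos_eq; last exact: rpow_ge0.
  exact: (rpow_abs_plus _ _ Rlt_0_1 Rlt_0_1).
apply: (@ex_series_plus R_AbsRing R_NormedModule).
  exact: (@ex_series_scal R_AbsRing R_NormedModule c _ (lp_summable x)).
exact: (@ex_series_scal R_AbsRing R_NormedModule c _ (lp_summable y)).
Qed.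

Lemma rpow_abs_scal (k u : K) :
  rpow (abs (mult k u)) p <= rpow (abs k) p * rpow (abs u) p.
Proof.
rewrite -rpowM; try exact: abs_ge_0.
by apply: rpow_le => //; apply: abs_mult.
Qed.

Lemma lp_scal_summable (k : K) (x : lp) :
  ex_series (fun n => rpow (abs (mult k (x n))) p).
Proof.
apply: (@ex_series_le R_AbsRing R_CompleteNormedModule _
  (fun n => rpow (abs k) p * rpow (abs (x n)) p)).
  move=> n; rewrite /norm /= /abs /= Rabs_pos_eq; last exact: rpow_ge0.
  exact: rpow_abs_scal.
exact: (@ex_series_scal R_AbsRing R_NormedModule (rpow (abs k) p) _
  (lp_summable x)).
Qed.

Lemma lp_opp_summable (x : lp) :
  ex_series (fun n => rpow (abs (opp (x n))) p).
Proof.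
by apply: ex_series_ext (lp_summable x) => n; rewrite abs_opp.
Qed.

Lemma lp_zero_summable : ex_series (fun n : nat => rpow (abs (@zero K)) p).
Proof.
exists 0; apply: (is_series_ext (fun=> zero)).
  by move=> n; rewrite abs_zero rpow_npos //; lra.
rewrite /is_series; apply: (filterlim_ext (fun=> zero)); last first.
  exact: filterlim_const.
by move=> n; rewrite /sum_n sum_n_m_const_zero.
Qed.

Definition lp_plus (x y : lp) : lp := Lp (lp_plus_summable x y).
Definition lp_opp (x : lp) : lp := Lp (lp_opp_summable x).
Definition lp_zero : lp := Lp lp_zero_summable.
Definition lp_scal (k : K) (x : lp) : lp := Lp (lp_scal_summable k x).

Lemma lp_plus_comm x y : lp_plus x y = lp_plus y x.
Proof. by apply: lp_ext => n /=; apply: plus_comm. Qed.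

Lemma lp_plus_assoc x y z : lp_plus x (lp_plus y z) = lp_plus (lp_plus x y) z.
Proof. by apply: lp_ext => n /=; apply: plus_assoc. Qed.

Lemma lp_plus_zero_r x : lp_plus x lp_zero = x.
Proof. by apply: lp_ext => n /=; apply: plus_zero_r. Qed.

Definition lp_AbelianMonoid_mixin :=
  AbelianMonoid.Mixin lp lp_plus lp_zero lp_plus_comm lp_plus_assoc
    lp_plus_zero_r.
Canonical lp_AbelianMonoid := AbelianMonoid.Pack lp lp_AbelianMonoid_mixin lp.

Lemma lp_plus_opp_r x : lp_plus x (lp_opp x) = lp_zero.
Proof. by apply: lp_ext => n /=; apply: plus_opp_r. Qed.

Definition lp_AbelianGroup_mixin :=
  AbelianGroup.Mixin lp_AbelianMonoid lp_opp lp_plus_opp_r.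
Canonical lp_AbelianGroup :=
  AbelianGroup.Pack lp (AbelianGroup.Class _ _ lp_AbelianGroup_mixin) lp.

Lemma lp_scal_assoc k l x : lp_scal k (lp_scal l x) = lp_scal (mult k l) x.
Proof. by apply: lp_ext => n /=; apply: mult_assoc. Qed.

Lemma lp_scal_one x : lp_scal one x = x.
Proof. by apply: lp_ext => n /=; apply: mult_one_l. Qed.

Lemma lp_scal_distr_l k x y :
  lp_scal k (lp_plus x y) = lp_plus (lp_scal k x) (lp_scal k y).
Proof. by apply: lp_ext => n /=; apply: mult_distr_l. Qed.

Lemma lp_scal_distr_r k l x :
  lp_scal (plus k l) x = lp_plus (lp_scal k x) (lp_scal l x).
Proof. by apply: lp_ext => n /=; apply: mult_distr_r. Qed.

Definition lp_ModuleSpace_mixin :=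
  ModuleSpace.Mixin K lp_AbelianGroup lp_scal lp_scal_assoc lp_scal_one
    lp_scal_distr_l lp_scal_distr_r.
Canonical lp_ModuleSpace :=
  ModuleSpace.Pack K lp (ModuleSpace.Class _ _ _ lp_ModuleSpace_mixin) lp.

Let term_ge0 (x : lp) n : 0 <= rpow (abs (x n)) p.
Proof. exact: rpow_ge0. Qed.

Lemma lp_Series_ge0 (x : lp) : 0 <= Series (fun n => rpow (abs (x n)) p).
Proof.
rewrite -[X in X <= _](Rmult_0_l (Series (fun n => rpow (abs (x n)) p))).
rewrite -Series_scal_l; apply: Series_le; last exact: lp_summable.
by move=> n; have := term_ge0 x n; lra.
Qed.

Lemma lp_normK (x : lp) :
  rpow (lp_norm x) p = Series (fun n => rpow (abs (x n)) p).
Proof. by rewrite rpowK //; apply: lp_Series_ge0. Qed.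

Lemma lp_norm_ge0 (x : lp) : 0 <= lp_norm x.
Proof. exact: rpow_ge0. Qed.

Lemma lp_norm_le (x : lp) (a : R) : 0 <= a ->
  Series (fun n => rpow (abs (x n)) p) <= rpow a p -> lp_norm x <= a.
Proof. by move=> a0 h; rewrite -(rpowK pK a0); apply: rpow_le. Qed.

Lemma lp_norm_triangle (x y : lp) :
  lp_norm (plus x y) <= lp_norm x + lp_norm y.
Proof.
have nx := lp_norm_ge0 x; have ny := lp_norm_ge0 y.
apply: le_epsilon => e e0.
pose a := lp_norm x + e / 2; pose b := lp_norm y + e / 2.
have a0 : 0 < a by rewrite /a; lra.
have b0 : 0 < b by rewrite /b; lra.
have -> : lp_norm x + lp_norm y + e = a + b by rewrite /a /b; field.
apply: lp_norm_le; first lra.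
have ra := @rpow_gt0 a p a0; have rb := @rpow_gt0 b p b0.
pose c := rpow (a + b) p * (a / (a + b) * / rpow a p).
pose d := rpow (a + b) p * (b / (a + b) * / rpow b p).
have r : 0 < rpow (a + b) p by apply: rpow_gt0; lra.
have c0 : 0 <= c.
  apply: Rmult_le_pos; first lra.
  apply: Rmult_le_pos; first by apply: Rdiv_le_0_compat; lra.
  exact/Rlt_le/Rinv_0_lt_compat.
have d0 : 0 <= d.
  apply: Rmult_le_pos; first lra.
  apply: Rmult_le_pos; first by apply: Rdiv_le_0_compat; lra.
  exact/Rlt_le/Rinv_0_lt_compat.
have sx := @ex_series_scal R_AbsRing R_NormedModule c _ (lp_summable x).
have sy := @ex_series_scal R_AbsRing R_NormedModule d _ (lp_summable y).
apply: Rle_trans (_ : Series (fun n => c * rpow (abs (x n)) p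
                                     + d * rpow (abs (y n)) p) <= _).
  apply: Series_le; last exact: (ex_series_plus _ _ sx sy).
  by move=> n; split; [exact: rpow_ge0|exact: rpow_abs_plus].
rewrite (Series_plus _ _ sx sy) !Series_scal_l -!lp_normK.
have hx : rpow (lp_norm x) p <= rpow a p by apply: rpow_le; rewrite /a; lra.
have hy : rpow (lp_norm y) p <= rpow b p by apply: rpow_le; rewrite /b; lra.
apply: Rle_trans (_ : c * rpow a p + d * rpow b p <= _).
  by apply: Rplus_le_compat; apply: Rmult_le_compat_l.
by right; rewrite /c /d; field; lra.
Qed.

Lemma lp_norm_scal (k : K) (x : lp) :
  lp_norm (scal k x) <= abs k * lp_norm x.
Proof.
have ak := abs_ge_0 k; have nx := lp_norm_ge0 x.
apply: lp_norm_le; first exact: Rmult_le_pos.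
rewrite rpowM // lp_normK -Series_scal_l.
apply: Series_le; last first.
  exact: (@ex_series_scal R_AbsRing R_NormedModule _ _ (lp_summable x)).
by move=> n; split; [exact: rpow_ge0|exact: rpow_abs_scal].
Qed.

Lemma lp_norm_eq_zero (x : lp) : lp_norm x = 0 -> x = zero.
Proof.
move=> x0; apply: lp_ext => n /=.
have S0 : Series (fun n => rpow (abs (x n)) p) = 0.
  by rewrite -lp_normK x0 rpow_npos //; lra.
apply: abs_eq_zero.
have t0 : rpow (abs (x n)) p <= 0.
  rewrite -S0.
  have hs := Series_correct _ (lp_summable x).
  have := @is_lim_seq_incr_compare (sum_n (fun n => rpow (abs (x n)) p)) _ hs.
  move=> /(_ _ n) h.
  apply: Rle_trans (h _); last first.
    by move=> k; rewrite sum_Sn /plus /=; have := term_ge0 x k.+1; lra.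
  case: n {h} => [|n]; first by rewrite sum_O; lra.
  rewrite sum_Sn /plus /=.
  have : 0 <= sum_n (fun n => rpow (abs (x n)) p) n.
    elim: n => [|n IH]; first by rewrite sum_O.
    by rewrite sum_Sn /plus /=; have := term_ge0 x n.+1; lra.
  by lra.
case: (Rle_lt_or_eq_dec _ _ (abs_ge_0 (x n))) => // h.
by have := rpow_gt0 p h; lra.
Qed.

Definition lp_ball (x : lp) (e : R) (y : lp) : Prop := lp_norm (minus y x) < e.

Lemma lp_norm_zero : lp_norm zero = 0.
Proof.
have z := @lp_norm_scal zero zero; rewrite abs_zero scal_zero_l in z.
change (lp_norm zero <= 0 * lp_norm zero) in z.
by have := lp_norm_ge0 zero; lra.
Qed.

Lemma lp_ball_center x (e : posreal) : lp_ball x e x.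
Proof.
by rewrite /lp_ball /minus plus_opp_r lp_norm_zero; apply: cond_pos.
Qed.

Lemma lp_ball_sym x y e : lp_ball x e y -> lp_ball y e x.
Proof.
rewrite /lp_ball -(opp_minus y x) -(scal_opp_one (minus y x)) => h.
apply: Rle_lt_trans (lp_norm_scal _ _) _.
by rewrite abs_opp_one Rmult_1_l.
Qed.

Lemma lp_ball_triangle x y z e f :
  lp_ball x e y -> lp_ball y f z -> lp_ball x (e + f) z.
Proof.
rewrite /lp_ball => h1 h2.
rewrite (minus_trans y); apply: Rle_lt_trans (lp_norm_triangle _ _) _.
by rewrite (Rplus_comm e); apply: Rplus_lt_compat.
Qed.

Definition lp_UniformSpace_mixin :=
  UniformSpace.Mixin lp zero lp_ball lp_ball_center lp_ball_sym
    lp_ball_triangle.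
Canonical lp_UniformSpace := UniformSpace.Pack lp lp_UniformSpace_mixin lp.

Canonical lp_NormedModuleAux :=
  NormedModuleAux.Pack K lp
    (NormedModuleAux.Class K lp (ModuleSpace.class K lp_ModuleSpace)
       lp_UniformSpace_mixin) lp.

Lemma lp_norm_ball1 (x y : lp) (e : R) : lp_norm (minus y x) < e -> ball x e y.
Proof. by []. Qed.

Lemma lp_norm_ball2 (x y : lp) (e : posreal) :
  ball x e y -> lp_norm (minus y x) < 1 * e.
Proof. by rewrite Rmult_1_l. Qed.

Definition lp_NormedModule_mixin :=
  NormedModule.Mixin K lp_NormedModuleAux lp_norm 1
    lp_norm_triangle lp_norm_scal lp_norm_ball1 lp_norm_ball2 lp_norm_eq_zero.
Canonical lp_NormedModule :=
  NormedModule.Pack K lp (NormedModule.Class _ _ _ lp_NormedModule_mixin) lp.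

End Lp.

Lemma Rle_1_2 : 1 <= 2. Proof. lra. Qed.

Definition l1 (K : AbsRing) : NormedModule K := lp_NormedModule K (Rle_refl 1).
Definition l2 (K : AbsRing) : NormedModule K := lp_NormedModule K Rle_1_2.

Definition update (m : nat) (X : Type) (x : 'I_m -> X) (i : 'I_m) (u : X) :
    'I_m -> X :=
  fun j => if j == i then u else x j.

Definition multilinear (K : AbsRing) (m : nat) (X Y : ModuleSpace K)
    (A : ('I_m -> X) -> Y) : Prop :=
  forall (x : 'I_m -> X) (i : 'I_m),
    (forall u v : X, A (update x i (plus u v)) =
       plus (A (update x i u)) (A (update x i v))) /\
    (forall (k : K) (u : X),
       A (update x i (scal k u)) = scal k (A (update x i u))).

Definition homogeneous_polynomial (K : AbsRing) (m : nat) (X Y : ModuleSpace K)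
    (P : X -> Y) : Prop :=
  exists A : ('I_m -> X) -> Y, multilinear A /\ forall x : X, P x = A (fun=> x).

Definition continuous_polynomial (K : AbsRing) (m : nat) (X Y : NormedModule K)
    (P : X -> Y) : Prop :=
  homogeneous_polynomial m P /\ forall x : X, continuous P x.

Definition polynomial_norm (K : AbsRing) (X Y : NormedModule K) (P : X -> Y) :
    Rbar :=
  Lub_Rbar (fun t => exists x : X, norm x <= 1 /\ t = norm (P x)).

(** [lam j i] and [x j i] are the scalars and vectors with lower index [j] and
    upper index [i]; only [1 <= j <= m1] and [1 <= i <= m2] matter.  The
    supremum is an extended real because finiteness is not built in. *)
Definition weak_sum (K : AbsRing) (p : R) (m : nat) (X : NormedModule K)
    (m1 m2 : nat) (lam : nat -> nat -> K) (x : nat -> nat -> X) : Rbar :=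
  Lub_Rbar (fun t => exists q : X -> AbsRing_NormedModule K,
    continuous_polynomial m q /\ Rbar_le (polynomial_norm q) 1 /\
    t = rpow (sum_n_m (fun j =>
          rpow (abs (sum_n_m (fun i => mult (lam j i) (q (x j i))) 1 m2)) p)
        1 m1) (1 / p)).

Definition factorable_strongly_summing (K : AbsRing) (p : R) (m : nat)
    (X Y : NormedModule K) (P : X -> Y) : Prop :=
  continuous_polynomial m P /\
  exists C : R, 0 <= C /\
    forall (m1 m2 : nat) (lam : nat -> nat -> K) (x : nat -> nat -> X),
      (0 < m1)%nat -> (0 < m2)%nat ->
      Rbar_le
        (rpow (sum_n_m (fun j =>
            rpow (norm (sum_n_m (fun i => scal (lam j i) (P (x j i))) 1 m2)) p)
          1 m1) (1 / p))
        (Rbar_mult C (weak_sum p m m1 m2 lam x)).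

(* Main.v *)
From HB Require Import structures.
From mathcomp Require Import all_boot all_order all_algebra.
From mathcomp Require ring lra.
From mathcomp Require Import reals Rstruct.
Require Import Defs.
From mathcomp Require Import ssreflect ssrfun ssrbool eqtype ssrnat fintype.
From Stdlib Require Import Reals Lra Psatz FunctionalExtensionality.
From Coquelicot Require Import Coquelicot.

(** A continuous [m]-homogeneous polynomial [P] on [l_1] factors through a
    bounded linear map on [l_1(nat^m)]: [P x] is the sum over the multi-indices
      [k] of
    [x_(k_1) ... x_(k_m) b_k], where [b_k] is the value at
    [(e_(k_1), ..., e_(k_m))] of the symmetric multilinear form of [P].
    Polarization expresses [b_k] through values of [P] on a fixed ball, so
    continuity of [P] bounds the [b_k] by a constant [C]
    ([bounded_coefficients]). By Grothendieck's theorem every bounded operator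
    from [l_1] to [l_2] is absolutely summing: if the scalar matrix [a_jk]
    satisfies [sum_j |sum_k a_jk t_k| <= B] for all real [|t_k| <= 1], then
    [sum_j ||sum_k a_jk b_k|| <= 64 B C] ([grothendieck_l2]).

    This is applied with [a_jk = sum_i lambda_j^i prod_l (x_j^i)_(k_l)], for
    which [sum_k a_jk b_k = sum_i lambda_j^i P(x_j^i)], whereas
    [sum_k a_jk t_k = sum_i lambda_j^i q(x_j^i)] for the polynomial [q] with
    coefficients [t_k]; that [q] is continuous of norm at most [1]
    ([test_poly_norm]), so the weak sum is an admissible [B]. The multi-indices
    are kept finite by truncating the vectors [x_j^i] to their first [N]
    coordinates, which only involves test polynomials in these coordinates;
    letting [N] tend to infinity uses the continuity of [P]
    ([factorable_of_continuous]).

    Grothendieck's inequality is proved for real scalars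
    ([grothendieck_inequality]). Unit vectors [u] of a Euclidean space are
    represented isometrically by the Rademacher sums [f_u = sum_d u_d eps_d],
    and the values of [f_u] are truncated to [[-2, 2]]. The truncated
    functions are uniformly bounded, so they contribute at most [4 A], where
    [A] is the norm of the bilinear form on [l_infty x l_infty]. By the fourth
    moment bound [E f_u^4 <= 3] the remainders have [L_2] norm at most [1/4],
    so each of the two error terms is at most a quarter of the bound [c]
    available for all Hilbert space vectors. Hence [c] improves to
    [4 A + c / 2], and iterating gives [8 A]. The complex case follows by
    taking real and imaginary parts. *)

Set Implicit Arguments.
Unset Strict Implicit.
Unset Printing Implicit Defensive.

(** * Grothendieck's inequality over finite index sets *)

Section Rademacher.
Import Order.TTheory GRing.Theory Num.Theory.
Import mathcomp.algebra_tactics.ring mathcomp.algebra_tactics.lra.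
Local Open Scope ring_scope.

(** The sign space [{-1, 1}^n], as an iterated product of copies of [bool]. *)
Fixpoint signs (n : nat) : finType :=
  if n is n'.+1 then (bool * signs n')%type else unit.

(** The Rademacher sum [sum_d u_d eps_d] at the sign vector [eps]. *)
Fixpoint rademacher (R : pzRingType) (n : nat) : ('I_n -> R) -> signs n -> R :=
  match n return ('I_n -> R) -> signs n -> R with
  | 0 => fun _ _ => 0
  | n'.+1 => fun u w => (-1) ^+ w.1 * u ord0
                        + rademacher (fun i => u (lift ord0 i)) w.2
  end.

Lemma sum_signsS (V : nmodType) n (F : signs n.+1 -> V) :
  \sum_w F w = \sum_(w : signs n) (F (true, w) + F (false, w)).
Proof.
rewrite (eq_bigr (fun w => F (w.1, w.2))); last by case.
rewrite -(pair_big xpredT xpredT (fun b w => F (b, w))) /=.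
by rewrite exchange_big /=; apply: eq_bigr => w _; rewrite big_bool.
Qed.

Variable R : archiRcfType.
Implicit Types (n : nat).

Lemma card_signs_gt0 n : 0 < (#|signs n|%:R : R).
Proof.
elim: n => [|n IH]; first by rewrite card_unit.
by rewrite card_prod card_bool natrM mulr_gt0.
Qed.

Lemma card_signsS n : (#|signs n.+1|%:R : R) = 2 * #|signs n|%:R.
Proof. by rewrite card_prod card_bool natrM. Qed.

(** Rademacher functions are orthonormal for the uniform probability. *)
Lemma rademacher_inner n (u v : 'I_n -> R) :
  \sum_w rademacher u w * rademacher v w
  = #|signs n|%:R * \sum_d u d * v d.
Proof.
elim: n u v => [|n IH] u v.
  by rewrite big_ord0 mulr0 big1 // => w _ /=; rewrite mulr0.
rewrite sum_signsS card_signsS big_ord_recl /= mulrDr.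
set u' := fun i => u (lift ord0 i); set v' := fun i => v (lift ord0 i).
have -> : 2 * #|signs n|%:R * (\sum_(i < n) u' i * v' i)
          = \sum_w 2 * (rademacher u' w * rademacher v' w).
  by rewrite -mulr_sumr IH mulrA.
have -> : 2 * #|signs n|%:R * (u ord0 * v ord0)
          = \sum_(w : signs n) (2 * (u ord0 * v ord0)).
  by rewrite sumr_const -mulr_natr; ring.
by rewrite -big_split; apply: eq_bigr => w _ /=; ring.
Qed.

(** Khinchin's inequality for the fourth moment. *)
Lemma rademacher_fourth n (u : 'I_n -> R) :
  \sum_w rademacher u w ^+ 4 <= #|signs n|%:R * (3 * (\sum_d u d ^+ 2) ^+ 2).
Proof.
elim: n u => [|n IH] u.
  by rewrite big_ord0 big1 ?expr0n ?mulr0 // => w _ /=; rewrite expr0n.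
rewrite sum_signsS card_signsS big_ord_recl /=.
set u' := fun i => u (lift ord0 i); set s := \sum_(i < n) _; set N := #|_|%:R.
set x := u ord0.
have -> : \sum_(w : signs n) (((-1) ^+ true * x + rademacher u' w) ^+ 4 +
                  ((-1) ^+ false * x + rademacher u' w) ^+ 4)
  = 2 * (\sum_w rademacher u' w ^+ 4)
    + 12 * x ^+ 2 * (\sum_w rademacher u' w * rademacher u' w)
    + \sum_(w : signs n) 2 * x ^+ 4.
  rewrite !mulr_sumr -!big_split; apply: eq_bigr => w _ /=; ring.
rewrite rademacher_inner sumr_const -[X in _ + X]mulr_natr -/N.
have -> : \sum_d u' d * u' d = s by apply: eq_bigr => i _; rewrite expr2.
have h := IH u'; rewrite -/N -/s in h.
apply: le_trans (_ : 2 * (N * (3 * s ^+ 2)) + 12 * x ^+ 2 * (N * s) + 2 * x ^+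
  4 * N <= _).
  by rewrite !lerD2r ler_pM2l.
have -> : 2 * N * (3 * (x ^+ 2 + s) ^+ 2)
  = 2 * (N * (3 * s ^+ 2)) + 12 * x ^+ 2 * (N * s) + 2 * x ^+ 4 * N
    + 4 * N * (x ^+ 2 * x ^+ 2) by ring.
by rewrite lerDl mulr_ge0 // mulr_ge0 // sqr_ge0.
Qed.

End Rademacher.

Section Truncation.
Import Order.TTheory GRing.Theory Num.Theory.
Import mathcomp.algebra_tactics.ring mathcomp.algebra_tactics.lra.
Local Open Scope ring_scope.
Variable R : realFieldType.

(** Truncation of a real number to the interval [-2, 2]. *)
Definition trunc2 (x : R) : R :=
  if x < -2 then -2 else if 2 < x then 2 else x.

Lemma trunc2_le x : `|trunc2 x| <= 2.
Proof.
by rewrite ler_norml /trunc2; case: ltP => h1; [|case: ltP => h2]; lra.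
Qed.

Lemma trunc2_sqr x : trunc2 x ^+ 2 <= x ^+ 2.
Proof. by rewrite /trunc2; case: ltP => h1; [|case: ltP => h2]; nra. Qed.

(** Beyond [|x| = 2] this is the inequality [|x| - 2 <= x^2 / 8], tangent at
    [|x| = 4]. *)
Lemma trunc2_err x : 64 * (x - trunc2 x) ^+ 2 <= x ^+ 4.
Proof.
have H (z : R) : 2 <= z -> 64 * (z - 2) ^+ 2 <= z ^+ 4.
  move=> z2; rewrite -subr_ge0.
  have -> : z ^+ 4 - 64 * (z - 2) ^+ 2 = (z - 4) ^+ 2 * (z ^+ 2 + 8 * (z - 2))
    by ring.
  by rewrite mulr_ge0 ?sqr_ge0 // addr_ge0 ?sqr_ge0 //; lra.
rewrite /trunc2; case: ltP => h1; [|case: ltP => h2].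
- have -> : x - -2 = - (- x - 2) by ring.
  have -> : x ^+ 4 = (- x) ^+ 4 by ring.
  by rewrite sqrrN; apply: H; lra.
- exact: H (ltW h2).
- by rewrite subrr expr0n mulr0; have := sqr_ge0 (x ^+ 2); rewrite -exprM.
Qed.
End Truncation.

Section Grothendieck.
Import Order.TTheory GRing.Theory Num.Theory.
Import mathcomp.algebra_tactics.ring mathcomp.algebra_tactics.lra.
Local Open Scope ring_scope.
Variables (R : archiRcfType) (I J : finType) (a : J -> I -> R) (A : R).

(** [A] bounds the norm of the bilinear form with matrix [a] on
    [l_infty x l_infty]. *)
Hypothesis aA : forall (s : J -> R) (t : I -> R),
  (forall j, `|s j| <= 1) -> (forall k, `|t k| <= 1) ->
  \sum_j \sum_k a j k * (s j * t k) <= A.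

(** [c] bounds the same form evaluated on the unit balls of all finite
    dimensional Euclidean spaces. *)
Definition hilbert_bound (c : R) : Prop :=
  forall n (y : J -> 'I_n -> R) (u : I -> 'I_n -> R),
  (forall j, \sum_d y j d ^+ 2 <= 1) -> (forall k, \sum_d u k d ^+ 2 <= 1) ->
  \sum_j \sum_k a j k * \sum_d y j d * u k d <= c.

Lemma inner_le_half (D : finType) (x y : D -> R) :
  `|\sum_d x d * y d| <= (\sum_d x d ^+ 2 + \sum_d y d ^+ 2) / 2.
Proof.
rewrite ler_norml -big_split /= mulr_suml -sumrN.
by apply/andP; split; apply: ler_sum => d _; have := sqr_ge0 (x d + y d);
   have := sqr_ge0 (x d - y d); nra.
Qed.

Lemma hilbert_bound_init : hilbert_bound (\sum_j \sum_k `|a j k|).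
Proof.
move=> n y u hy hu; apply: ler_sum => j _; apply: ler_sum => k _.
apply: le_trans (ler_norm _) _; rewrite normrM ler_piMr //.
apply: le_trans (inner_le_half _ _) _.
by have := hy j; have := hu k; lra.
Qed.

(** The bound transfers to inner products over any finite index set, with
    radii [r] and [s] for the two families. *)
Lemma hilbert_bound_scaled c (D : finType) (r s : R)
    (y : J -> D -> R) (u : I -> D -> R) :
  hilbert_bound c -> 0 < r -> 0 < s ->
  (forall j, \sum_d y j d ^+ 2 <= r ^+ 2) ->
  (forall k, \sum_d u k d ^+ 2 <= s ^+ 2) ->
  \sum_j \sum_k a j k * \sum_d y j d * u k d <= r * s * c.
Proof.
move=> hc r0 s0 hy hu.
have sum_enum (F : D -> R) : \sum_d F d = \sum_(i < #|D|) F (enum_val i).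
  exact/reindex/onW_bij/enum_val_bij.
have sq (t : R) (z : D -> R) : 0 < t -> \sum_d z d ^+ 2 <= t ^+ 2 ->
    \sum_(d < #|D|) (z (enum_val d) / t) ^+ 2 <= 1.
  move=> t0 h; under eq_bigr do rewrite expr_div_n.
  rewrite -mulr_suml ler_pdivrMr ?exprn_gt0 // mul1r.
  by rewrite -(sum_enum (fun d => z d ^+ 2)).
have h := hc _ _ _ (fun j => sq _ _ r0 (hy j)) (fun k => sq _ _ s0 (hu k)).
have {h} := ler_wpM2l (ltW (mulr_gt0 r0 s0)) h; congr (_ <= _).
rewrite mulr_sumr; apply: eq_bigr => j _; rewrite mulr_sumr;
  apply: eq_bigr => k _.
rewrite mulrCA; congr (_ * _).
rewrite (sum_enum (fun d => y j d * u k d)) mulr_sumr.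
by apply: eq_bigr => d _; field; rewrite !gt_eqF.
Qed.

(** For vectors with coordinates in [[-2, 2]] the bound holds coordinatewise,
    whatever their Euclidean norm. *)
Lemma bilinear_bound2 (D : finType) (y : J -> D -> R) (u : I -> D -> R) :
  (forall j d, `|y j d| <= 2) -> (forall k d, `|u k d| <= 2) ->
  \sum_j \sum_k a j k * \sum_d y j d * u k d <= #|D|%:R * (4 * A).
Proof.
move=> hy hu.
have -> : \sum_j \sum_k a j k * \sum_d y j d * u k d
  = \sum_d \sum_j \sum_k a j k * (y j d * u k d).
  under eq_bigr do under eq_bigr do rewrite mulr_sumr.
  under eq_bigr do rewrite exchange_big.
  by rewrite exchange_big.
apply: le_trans (_ : \sum_(d : D) 4 * A <= _);
  last by rewrite sumr_const -[X in X <= _]mulr_natl.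
apply: ler_sum => d _.
have h2 (z : R) : `|z| <= 2 -> `|z / 2| <= 1.
  by rewrite !ler_norml => /andP[z1 z2]; apply/andP; split; lra.
have h := aA (fun j => h2 _ (hy j d)) (fun k => h2 _ (hu k d)).
have {h} := ler_wpM2l (ler0n R 4) h; congr (_ <= _).
rewrite mulr_sumr; apply: eq_bigr => j _; rewrite mulr_sumr;
  apply: eq_bigr => k _ /=.
by field.
Qed.

(** Both Rademacher sums are split into truncation and remainder; the product
    of the truncations contributes [4 A], each remainder term [c / 4]. *)
Lemma hilbert_bound_step c :
  0 <= c -> hilbert_bound c -> hilbert_bound (4 * A + c / 2).
Proof.
move=> c0 hc n y u hy hu.
(* Sums over [signs n] are [N] times expectations, so unit vectors become
   functions of norm at most [r = sqrt N]. *)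
pose N : R := #|signs n|%:R.
have N0 : 0 < N := card_signs_gt0 R n.
pose r := Num.sqrt N.
have r0 : 0 < r by rewrite sqrtr_gt0.
have rr : r ^+ 2 = N by rewrite sqr_sqrtr // ltW.
pose f k := rademacher (u k); pose g j := rademacher (y j).
pose f2 k w := trunc2 (f k w); pose g2 j w := trunc2 (g j w).
have sq_le (v : 'I_n -> R) :
    \sum_d v d ^+ 2 <= 1 -> \sum_w rademacher v w ^+ 2 <= r ^+ 2.
  move=> hv; rewrite rr; under eq_bigr do rewrite expr2.
  by rewrite rademacher_inner ler_piMr // ltW.
have err_le (v : 'I_n -> R) : \sum_d v d ^+ 2 <= 1 ->
    \sum_w (rademacher v w - trunc2 (rademacher v w)) ^+ 2 <= (r / 4) ^+ 2.
  (* The fourth moment gives [3 N / 64], which is at most [N / 16]. *)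
  move=> hv; have s0 : 0 <= \sum_d v d ^+ 2 by apply: sumr_ge0 => d _;
    apply: sqr_ge0.
  have := rademacher_fourth v; rewrite -/N => h4.
  have h1 : 64 * \sum_w (rademacher v w - trunc2 (rademacher v w)) ^+
    2 <= \sum_w rademacher v w ^+ 4.
    by rewrite mulr_sumr; apply: ler_sum => w _; apply: trunc2_err.
  have h2 : N * (3 * (\sum_d v d ^+ 2) ^+ 2) <= N * (3 * 1).
    by rewrite ler_pM2l // ler_pM2l // expr_le1.
  have -> : (r / 4) ^+ 2 = N / 16 by rewrite expr_div_n rr; congr (_ / _); ring.
  by lra.
have g2_le j : \sum_w g2 j w ^+ 2 <= r ^+ 2.
  by apply: le_trans (sq_le _ (hy j)); apply: ler_sum => w _; apply: trunc2_sqr.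
have r4 : 0 < r / 4 by rewrite divr_gt0.
have h1 := bilinear_bound2 (fun j w => trunc2_le (g j w))
  (fun k w => trunc2_le (f k w)).
have h2 := hilbert_bound_scaled hc r0 r4 g2_le (fun k => err_le _ (hu k)).
have h3 := hilbert_bound_scaled hc r4 r0 (fun j => err_le _ (hy j))
  (fun k => sq_le _ (hu k)).
rewrite -(ler_pM2l N0).
have -> : N * (4 * A + c / 2) = N * (4 * A) + r * (r / 4) * c + r / 4 * r * c.
  by rewrite -rr; field.
apply: le_trans (lerD (lerD h1 h2) h3).
rewrite -!big_split mulr_sumr; apply: ler_sum => j _ /=.
rewrite -!big_split mulr_sumr; apply: ler_sum => k _ /=.
rewrite -!mulrDr mulrCA -rademacher_inner -!big_split /= le_eqVlt; apply/orP;
  left; apply/eqP.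
by congr (_ * _); apply: eq_bigr => w _; rewrite /g2 /g /f; ring.
Qed.

(** Grothendieck's inequality: truncating the Rademacher representation of
    the vectors improves a bound [8 A + e] to [8 A + e / 2]. *)
Lemma grothendieck_inequality : hilbert_bound (8 * A).
Proof.
have A0 : 0 <= A.
  have := aA (s := fun=> 0) (t := fun=> 0);
    rewrite !normr0 ler01 => /(_ (fun=> isT) (fun=> isT)).
  by rewrite big1 // => j _; rewrite big1 // => k _; rewrite !mulr0.
pose e := \sum_j \sum_k `|a j k|.
have e0 : 0 <= e by apply: sumr_ge0 => j _; apply: sumr_ge0.
have hm m : hilbert_bound (8 * A + e / 2 ^+ m).
  elim: m => [|m IH].
    rewrite expr0 divr1 => n y u hy hu.
    by apply: le_trans (hilbert_bound_init hy hu) _; rewrite -/e; lra.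
  have p : 0 <= 8 * A + e / 2 ^+ m.
    by rewrite addr_ge0 ?divr_ge0 ?exprn_ge0 //; lra.
  have := hilbert_bound_step p IH.
  have -> // : 4 * A + (8 * A + e / 2 ^+ m) / 2 = 8 * A + e / 2 ^+ m.+1.
  by rewrite exprS invfM; move: (_ ^+ m)^-1 => z; field.
move=> n y u hy hu; apply/ler_addgt0Pr => d d0.
pose m := Num.bound (e / d).
apply: le_trans (hm m n y u hy hu) _; rewrite lerD2l.
rewrite ler_pdivrMr ?exprn_gt0 // mulrC -ler_pdivrMr //.
apply: le_trans (ltW (archi_boundP _)) _; first by rewrite divr_ge0 // ltW.
by rewrite -natrX ler_nat ltnW // ltn_expl.
Qed.

End Grothendieck.

Section GrothendieckNorm.
Import Order.TTheory GRing.Theory Num.Theory.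
Local Open Scope ring_scope.

(** Grothendieck's theorem for operators from [l_1^I] into a Euclidean space:
    the operator sending the basis vector of index [k] to [u k] is absolutely
    summing. *)
Lemma grothendieck_summing (R : archiRcfType) (I J : finType) (a : J -> I -> R)
    (B c : R) (n : nat) (u : I -> 'I_n -> R) :
  (forall t : I -> R, (forall k, `|t k| <= 1) ->
     \sum_j `|\sum_k a j k * t k| <= B) ->
  0 < c -> (forall k, \sum_d u k d ^+ 2 <= c ^+ 2) ->
  \sum_j Num.sqrt (\sum_d (\sum_k a j k * u k d) ^+ 2) <= 8 * B * c.
Proof.
move=> aB c0 hu.
pose v j d := \sum_k a j k * u k d; pose N j := Num.sqrt (\sum_d v j d ^+ 2).
have NN j : N j ^+ 2 = \sum_d v j d ^+ 2.
  by rewrite sqr_sqrtr // sumr_ge0 // => d _; apply: sqr_ge0.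
have aA (s : J -> R) (t : I -> R) :
  (forall j, `|s j| <= 1) -> (forall k, `|t k| <= 1) ->
  \sum_j \sum_k a j k * (s j * t k) <= B.
  move=> hs ht; apply: le_trans (aB t ht); apply: ler_sum => j _.
  have -> : \sum_k a j k * (s j * t k) = s j * \sum_k a j k * t k.
    by rewrite mulr_sumr; apply: eq_bigr => k _; rewrite mulrCA.
  by apply: le_trans (ler_norm _) _; rewrite normrM ler_piMl.
have hy j : \sum_d (v j d / N j) ^+ 2 <= 1 ^+ 2.
  under eq_bigr do rewrite expr_div_n.
  by rewrite -mulr_suml -NN expr1n -expr_div_n;
    case: (eqVneq (N j) 0) => [->|nz];
     rewrite ?invr0 ?mulr0 ?expr0n // divff // expr1n.
(* Duality: pair each vector [v j] with its normalization, which is zero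
   when [v j] vanishes. *)
have := hilbert_bound_scaled (grothendieck_inequality aA) ltr01 c0 hy hu.
rewrite mul1r mulrC; apply: le_trans; apply: ler_sum => j _.
have -> : \sum_k a j k * (\sum_d v j d / N j * u k d)
    = \sum_d v j d / N j * v j d.
  under eq_bigr do rewrite mulr_sumr.
  by rewrite exchange_big; apply: eq_bigr => d _; rewrite mulr_sumr;
     apply: eq_bigr => k _; rewrite mulrCA.
have -> : \sum_d v j d / N j * v j d = N j ^+ 2 / N j.
  by rewrite NN mulr_suml; apply: eq_bigr => d _; rewrite expr2 mulrAC.
by rewrite -/(N j); case: (eqVneq (N j) 0) => [->|nz];
  rewrite ?invr0 ?mulr0 // expr2 mulfK.
Qed.

End GrothendieckNorm.

Local Open Scope R_scope.

(** * Scalars and finite sums *)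

(* Finite sums and products in abstract monoids and rings are written with
   the iterated operators over [plus] and [mult]. *)
HB.instance Definition _ (G : AbelianMonoid) :=
  Monoid.isComLaw.Build G zero plus (@plus_assoc G) (@plus_comm G)
    (@plus_zero_l G).
HB.instance Definition _ (K : Ring) :=
  Monoid.isLaw.Build K one mult (@mult_assoc K) (@mult_one_l K) (@mult_one_r K).
HB.instance Definition _ (K : Ring) :=
  Monoid.isMulLaw.Build K zero mult (@mult_zero_l K) (@mult_zero_r K).
HB.instance Definition _ (K : Ring) :=
  Monoid.isAddLaw.Build K mult plus (@mult_distr_r K) (@mult_distr_l K).

(** What the argument uses of the real and of the complex numbers: real and
    imaginary parts that determine the scalar, an embedding [emb] of the
    reals, and the Euclidean absolute value. Commutativity of the product
    follows. *)
Record scalars := Scalars {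
  scalar_ring :> AbsRing;
  re : scalar_ring -> R;
  im : scalar_ring -> R;
  emb : R -> scalar_ring;
  scalar_ext : forall x y, re x = re y -> im x = im y -> x = y;
  reD : forall x y, re (plus x y) = re x + re y;
  imD : forall x y, im (plus x y) = im x + im y;
  reM : forall x y, re (mult x y) = re x * re y - im x * im y;
  imM : forall x y, im (mult x y) = re x * im y + im x * re y;
  re_emb : forall r, re (emb r) = r;
  im_emb : forall r, im (emb r) = 0;
  sqr_abs : forall x : scalar_ring, abs x * abs x = re x * re x + im x * im x }.

Definition real_scalars : scalars.
Proof.
apply: (@Scalars R_AbsRing (fun x => x) (fun=> 0) (fun x => x)) => //=.
- by move=> _ _; rewrite Rplus_0_r.
- by move=> x y; rewrite Rmult_0_r Rminus_0_r.
- by move=> x y; rewrite Rmult_0_r Rmult_0_l Rplus_0_r.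
- by move=> x; rewrite /abs /= -Rabs_mult Rabs_pos_eq; [ring|nra].
Defined.

Definition complex_scalars : scalars.
Proof.
apply: (@Scalars C_AbsRing fst snd (fun x => (x, 0))) => //=.
- by move=> [a b] [c d] /= -> ->.
- by move=> x; rewrite /abs /= /Cmod sqrt_sqrt /=; [ring|nra].
Defined.

Section ScalarTheory.
Variable K : scalars.
Implicit Types x y z : K.

Lemma re0 : re (zero : K) = 0.
Proof. by have := reD (zero : K) zero; rewrite plus_zero_l; lra. Qed.

Lemma im0 : im (zero : K) = 0.
Proof. by have := imD (zero : K) zero; rewrite plus_zero_l; lra. Qed.

Lemma scalar_multC x y : mult x y = mult y x.
Proof. by apply: scalar_ext; rewrite !(reM, imM); lra. Qed.

Lemma embM r s : emb K (r * s) = mult (emb K r) (emb K s).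
Proof. by apply: scalar_ext; rewrite !(reM, imM, re_emb, im_emb); lra. Qed.

Lemma embD r s : emb K (r + s) = plus (emb K r) (emb K s).
Proof. by apply: scalar_ext; rewrite !(reD, imD, re_emb, im_emb); lra. Qed.

Lemma emb1 : emb K 1 = one.
Proof.
rewrite -[LHS]mult_one_r.
by apply: scalar_ext; rewrite !(reM, imM, re_emb, im_emb); lra.
Qed.

Lemma emb0 : emb K 0 = zero.
Proof. by apply: scalar_ext; rewrite !(re_emb, im_emb, re0, im0). Qed.

Lemma abs_re_le x : Rabs (re x) <= abs x.
Proof.
apply: Rsqr_incr_0_var; last exact: abs_ge_0.
by rewrite -Rsqr_abs /Rsqr sqr_abs; nra.
Qed.

Lemma abs_im_le x : Rabs (im x) <= abs x.
Proof.
apply: Rsqr_incr_0_var; last exact: abs_ge_0.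
by rewrite -Rsqr_abs /Rsqr sqr_abs; nra.
Qed.

Lemma abs_emb r : abs (emb K r) = Rabs r.
Proof.
apply: Rsqr_inj; [exact: abs_ge_0|exact: Rabs_pos|].
by rewrite -Rsqr_abs /Rsqr sqr_abs re_emb im_emb; ring.
Qed.

Lemma re_sum (I : finType) (F : I -> K) :
  re (\big[plus/zero]_k F k) = \big[Rplus/0]_k re (F k).
Proof. exact: (big_morph (@re K) (@reD K) re0). Qed.

Lemma im_sum (I : finType) (F : I -> K) :
  im (\big[plus/zero]_k F k) = \big[Rplus/0]_k im (F k).
Proof. exact: (big_morph (@im K) (@imD K) im0). Qed.

HB.instance Definition _ :=
  SemiGroup.isCommutativeLaw.Build K mult scalar_multC.

End ScalarTheory.

Section Sums.
Variables (K : AbsRing).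

Lemma scal_sumr (X : ModuleSpace K) (I : finType) (P : pred I)
    (a : K) (F : I -> X) :
  scal a (\big[plus/zero]_(i | P i) F i) =
  \big[plus/zero]_(i | P i) scal a (F i).
Proof. exact: (big_morph (scal a) (scal_distr_l a) (scal_zero_r a)). Qed.

Lemma scal_suml (X : ModuleSpace K) (I : finType) (P : pred I)
    (c : I -> K) (v : X) :
  scal (\big[plus/zero]_(i | P i) c i) v =
  \big[plus/zero]_(i | P i) scal (c i) v.
Proof.
apply: (big_morph (fun a => scal a v)); last exact: scal_zero_l.
by move=> a b; apply: scal_distr_r.
Qed.

Lemma norm_sum_le (X : NormedModule K) (I : finType) (P : pred I)
    (F : I -> X) (b : I -> R) :
  (forall i, norm (F i) <= b i) ->
  norm (\big[plus/zero]_(i | P i) F i) <= \big[Rplus/0]_(i | P i) b i.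
Proof.
move=> Fb; elim/big_rec2: _ => [|i y x _ h]; first by rewrite norm_zero; lra.
by apply: Rle_trans (norm_triangle _ _) _; have := Fb i; lra.
Qed.

Lemma abs_prod_le (I : finType) (F : I -> K) (b : I -> R) :
  (forall i, abs (F i) <= b i) ->
  abs (\big[mult/one]_i F i) <= \big[Rmult/1]_i b i.
Proof.
move=> Fb; elim/big_rec2: _ => [|i y x _ h]; first by rewrite abs_one; lra.
apply: Rle_trans (abs_mult _ _) _.
by apply: Rmult_le_compat => //; apply: abs_ge_0.
Qed.

End Sums.

Section RealSums.
Variables (I : finType) (P : pred I).
Implicit Types F G : I -> R.

Lemma Rsum_ge0 F : (forall i, 0 <= F i) -> 0 <= \big[Rplus/0]_(i | P i) F i.
Proof. by move=> F0; elim/big_rec: _ => [|i r _ r0]; [|have := F0 i]; lra. Qed.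

Lemma Rsum_le F G : (forall i, F i <= G i) ->
  \big[Rplus/0]_(i | P i) F i <= \big[Rplus/0]_(i | P i) G i.
Proof.
by move=> FG; elim/big_rec2: _ => [|i r s _ h]; [|have := FG i]; lra.
Qed.

Lemma Rsum_scal c F :
  \big[Rplus/0]_(i | P i) (c * F i) = c * \big[Rplus/0]_(i | P i) F i.
Proof.
by symmetry; apply: (big_morph (Rmult c)) => [x y|];
  rewrite ?Rmult_0_r ?Rmult_plus_distr_l.
Qed.

End RealSums.

Section PartialSums.
Variable G : AbelianMonoid.

Lemma sum_n_big (a : nat -> G) n : sum_n a n = \big[plus/zero]_(i < n.+1) a i.
Proof.
elim: n => [|n IH]; first by rewrite sum_O big_ord_recr big_ord0 /= plus_zero_l.
by rewrite sum_Sn IH [RHS]big_ord_recr.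
Qed.

Lemma sum_n_m_big (a : nat -> G) n :
  sum_n_m a 1 n = \big[plus/zero]_(i < n) a i.+1.
Proof.
elim: n => [|n IH]; first by rewrite sum_n_m_zero ?big_ord0 //;
  apply: Nat.lt_0_1.
by rewrite sum_n_Sm ?IH ?[RHS]big_ord_recr //; apply/le_n_S/Nat.le_0_l.
Qed.

End PartialSums.

Lemma filterlim_sum (K : AbsRing) (V : NormedModule K) (T I : Type)
    (F : (T -> Prop) -> Prop) (FF : Filter F) (r : seq I)
    (f : I -> T -> V) (l : I -> V) :
  (forall i, filterlim (f i) F (locally (l i))) ->
  filterlim (fun t => \big[plus/zero]_(i <- r) f i t) F
            (locally (\big[plus/zero]_(i <- r) l i)).
Proof.
move=> fl; elim: r => [|i r IH].
  rewrite big_nil; apply: filterlim_ext (filterlim_const _).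
  by move=> t; rewrite big_nil.
rewrite big_cons; apply: (filterlim_ext
  (fun t => plus (f i t) (\big[plus/zero]_(j <- r) f j t))).
  by move=> t; rewrite big_cons.
exact: (@filterlim_comp_2 _ _ _ _ F _ _ _ FF (f i) _ plus (fl i) IH
  (filterlim_plus _ _)).
Qed.

Lemma continuous_prod (U : UniformSpace) (K : AbsRing) (I : Type) (r : seq I)
    (f : I -> U -> K) (x : U) :
  (forall i, continuous (f i) x) ->
  continuous (fun y => \big[mult/one]_(i <- r) f i y) x.
Proof.
move=> cf; elim: r => [|i r IH].
  apply: (@continuous_ext U (AbsRing_UniformSpace K) (fun=> one : K));
    last exact: continuous_const.
  by move=> y; rewrite big_nil.
apply: (@continuous_ext U (AbsRing_UniformSpace K)
    (fun y => mult (f i y) (\big[mult/one]_(j <- r) f j y))).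
  by move=> y; rewrite big_cons.
exact: continuous_mult.
Qed.

(** * Polarization of homogeneous polynomials *)

Section Multilinear.
Variables (K : AbsRing) (X Y : ModuleSpace K).

(** The family of length [m + 1] with head [x0] and tail [y]. *)
Definition fam_cons (T : Type) m (x0 : T) (y : 'I_m -> T) : 'I_m.+1 -> T :=
  fun i => if unlift ord0 i is Some j then y j else x0.

Lemma update_cons0 (T : Type) m (x0 x1 : T) (y : 'I_m -> T) :
  update (fam_cons x0 y) ord0 x1 = fam_cons x1 y.
Proof.
apply: functional_extensionality => i; rewrite /update /fam_cons.
by case: unliftP => [j ->|->]; rewrite ?eqxx // eq_sym (negPf (neq_lift _ _)).
Qed.

Lemma update_consS (T : Type) m (x0 : T) (y : 'I_m -> T) j u :
  update (fam_cons x0 y) (lift ord0 j) u = fam_cons x0 (update y j u).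
Proof.
apply: functional_extensionality => i; rewrite /update /fam_cons.
case: unliftP => [k ->|->]; first by rewrite (inj_eq lift_inj).
by rewrite (negPf (neq_lift _ _)).
Qed.

Lemma multilinear_tail m (A : ('I_m.+1 -> X) -> Y) x0 :
  multilinear A -> multilinear (fun y => A (fam_cons x0 y)).
Proof.
by move=> hA y j; have [h1 h2] := hA (fam_cons x0 y) (lift ord0 j); split=> *;
   rewrite -!update_consS ?h1 ?h2.
Qed.

Lemma multilinear_head_sum m (A : ('I_m.+1 -> X) -> Y) (I : finType)
    (c : I -> K) (e : I -> X) y :
  multilinear A ->
  A (fam_cons (\big[plus/zero]_k scal (c k) (e k)) y) =
  \big[plus/zero]_k scal (c k) (A (fam_cons (e k) y)).
Proof.
move=> hA; have [h1 h2] := hA (fam_cons zero y) ord0.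
have hD u v : A (fam_cons (plus u v) y) =
    plus (A (fam_cons u y)) (A (fam_cons v y)).
  by have := h1 u v; rewrite !update_cons0.
have hS a u : A (fam_cons (scal a u) y) = scal a (A (fam_cons u y)).
  by have := h2 a u; rewrite !update_cons0.
have h0 : A (fam_cons zero y) = zero.
  by rewrite -(scal_zero_l (zero : X)) hS scal_zero_l.
by rewrite (big_morph (fun u => A (fam_cons u y)) hD h0); apply: eq_bigr.
Qed.

Lemma big_ffun_cons m (I : finType) (F : {ffun 'I_m.+1 -> I} -> Y) :
  \big[plus/zero]_f F f =
  \big[plus/zero]_k \big[plus/zero]_(g : {ffun 'I_m -> I})
     F [ffun i => fam_cons k g i].
Proof.
rewrite pair_big /=.
rewrite (reindex (fun p : I * {ffun 'I_m -> I} =>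
  [ffun i => fam_cons p.1 p.2 i])) //.
exists (fun f : {ffun 'I_m.+1 -> I} => (f ord0, [ffun j => f (lift ord0 j)]))
  => [[k g]|f] _ /=.
  rewrite ffunE /fam_cons unlift_none; congr pair; apply/ffunP => j.
  by rewrite !ffunE liftK.
apply/ffunP => i; rewrite ffunE /fam_cons.
by case: unliftP => [j ->|->]; rewrite ?ffunE.
Qed.

Lemma multilinear_expand m (A : ('I_m -> X) -> Y) (I : finType)
    (c : I -> K) (e : I -> X) :
  multilinear A ->
  A (fun=> \big[plus/zero]_k scal (c k) (e k)) =
  \big[plus/zero]_(f : {ffun 'I_m -> I})
     scal (\big[mult/one]_i c (f i)) (A (fun i => e (f i))).
Proof.
elim: m A => [|m IH] A hA.
  rewrite (big_pred1 [ffun i : 'I_0 => False_rect I (notF (ltn_ord i))]);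
    last first.
    by move=> f; symmetry; apply/eqP/ffunP => -[].
  by rewrite big_ord0 scal_one; congr A;
    apply: functional_extensionality => -[].
set s := \big[plus/zero]_k _.
have -> : (fun=> s) = fam_cons s (fun=> s) :> ('I_m.+1 -> X).
  by apply: functional_extensionality => i; rewrite /fam_cons; case: unlift.
rewrite multilinear_head_sum // big_ffun_cons; apply: eq_bigr => k _.
rewrite (IH (fun y => A (fam_cons (e k) y)) (multilinear_tail _ hA)) scal_sumr.
apply: eq_bigr => g _; rewrite scal_assoc; congr scal.
  rewrite big_ord_recl ffunE /fam_cons unlift_none; congr mult.
  by apply: eq_bigr => i _; rewrite ffunE liftK.
congr A; apply: functional_extensionality => i; rewrite /fam_cons ffunE.
by case: unliftP.
Qed.

End Multilinear.

Section Polarization.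
Variable K : scalars.

(** For a subset [S], given by its boolean indicator, [prod_k sgn (S k)] is
    the sign of the parity of the complement of [S], and [ind] is the
    indicator with values in [K]. *)
Definition sgn (b : bool) : K := if b then one else opp one.
Definition ind (b : bool) : K := if b then one else zero.

Lemma abs_sgn b : abs (sgn b) = 1.
Proof. by case: b; rewrite /= ?abs_opp_one ?abs_one. Qed.

Lemma abs_ind_le b : abs (ind b) <= 1.
Proof. by case: b; rewrite /= ?abs_zero ?abs_one; lra. Qed.

Lemma prod_ind (I : finType) (b : pred I) :
  \big[mult/one]_i ind (b i) = ind [forall i, b i].
Proof.
case: forallP => [h|/forallP]; first by rewrite big1 // => i _; rewrite h.
by rewrite negb_forall => /existsP[i /negbTE hi];
  rewrite (bigD1 i) //= hi mult_zero_l.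
Qed.

(** Inclusion-exclusion: the signed sum over all subsets of the indicator
    that the subset contains the range of [f] vanishes unless [f] is onto. *)
Lemma signed_sum_subsets m (f : {ffun 'I_m -> 'I_m}) :
  \big[plus/zero]_(S : {ffun 'I_m -> bool})
     mult (\big[mult/one]_k sgn (S k)) (\big[mult/one]_i ind (S (f i)))
  = ind (injectiveb f).
Proof.
transitivity (\big[plus/zero]_(S : {ffun 'I_m -> bool})
    \big[mult/one]_k mult (sgn (S k)) (ind ((k \in codom f) ==> S k))).
  apply: eq_bigr => S _; rewrite big_split; congr mult; rewrite !prod_ind;
    congr ind.
  apply/forallP/forallP => [h k|h i]; last by have := h (f i); rewrite codom_f.
  by apply/implyP => /codomP[i ->].
rewrite -(bigA_distr_bigA (fun k b =>
  mult (sgn b) (ind ((k \in codom f) ==> b)))).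
transitivity (\big[mult/one]_k ind (k \in codom f)).
  apply: eq_bigr => k _; rewrite big_bool implybT implybF mult_one_l.
  by case: (k \in codom f); rewrite /= ?mult_zero_r ?plus_zero_r // mult_one_r
    plus_opp_r.
rewrite prod_ind; congr ind; apply/forallP/injectiveP => [h|h k].
  have /image_injP h2 : #|codom f| == #|'I_m| by apply/eqP/eq_card => k;
    rewrite h.
  by move=> x y; apply: h2.
by have [g _ gK] := injF_bij h; rewrite -(gK k) codom_f.
Qed.

Variables (X Y : NormedModule K) (m : nat) (P : X -> Y).

Section Form.
Variable A : ('I_m -> X) -> Y.
Hypotheses (hA : multilinear A) (PA : forall x, P x = A (fun=> x)).

(** The polarization formula, with sums over subsets of the vectors; the
    right-hand side is the symmetrization of [A] times [m!]. *)
Lemma polarization (e : 'I_m -> X) :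
  \big[plus/zero]_(S : {ffun 'I_m -> bool})
     scal (\big[mult/one]_k sgn (S k))
          (P (\big[plus/zero]_k scal (ind (S k)) (e k)))
  = \big[plus/zero]_(f : {ffun 'I_m -> 'I_m} | injectiveb f) A
    (fun i => e (f i)).
Proof.
under eq_bigr do rewrite PA (multilinear_expand _ _ hA) scal_sumr.
rewrite exchange_big [RHS]big_mkcond; apply: eq_bigr => f _ /=.
under eq_bigr do rewrite scal_assoc.
rewrite -scal_suml signed_sum_subsets.
by case: injectiveb; rewrite ?scal_one ?scal_zero_l.
Qed.

(** A weak form of homogeneity, enough to bound [P] on every ball from a bound
    on one ball. *)
Lemma polynomial_scal_bound (a : K) :
  exists2 c, 0 <= c & forall x, norm (P (scal a x)) <= c * norm (P x).
Proof.
pose b := \big[mult/one]_(i < m) a.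
exists (\big[Rplus/0]_(f : {ffun 'I_m -> unit}) abs b) => [|x].
  by elim/big_rec: _ => [|f r _ r0]; have := abs_ge_0 b; lra.
(* The expansion along the one-element family [x] gives the factor [a^m]. *)
have -> : scal a x = \big[plus/zero]_(k : unit) scal a x.
  by rewrite (big_pred1 tt) // => -[].
rewrite !PA (multilinear_expand (fun=> a) (fun=> x) hA).
apply: Rle_trans (norm_sum_le _ (b := fun=> abs b * norm (A (fun=> x))) _) _.
  by move=> f; apply: norm_scal.
set t := norm _; right; symmetry.
exact: (big_morph (fun r => r * t) (fun r s => Rmult_plus_distr_r r s t)
  (Rmult_0_l t)).
Qed.

(** The coefficients [prod_i c (k i)] do not see a permutation of the
    multi-index, so the arguments of [A] may be permuted. *)
Lemma polynomial_reindex (I : finType) (c : I -> K) (e : I -> X)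
    (f : {ffun 'I_m -> 'I_m}) :
  injective f ->
  P (\big[plus/zero]_k scal (c k) (e k)) =
  \big[plus/zero]_(k : {ffun 'I_m -> I})
     scal (\big[mult/one]_i c (k i)) (A (fun i => e (k (f i)))).
Proof.
move=> inj_f; have [g fK gK] := injF_bij inj_f.
rewrite PA (multilinear_expand _ _ hA).
rewrite (reindex (fun k : {ffun 'I_m -> I} => [ffun i => k (f i)])) /=;
  last first.
  exists (fun k : {ffun 'I_m -> I} => [ffun i => k (g i)]) => k _;
    by apply/ffunP => i; rewrite !ffunE ?fK ?gK.
apply: eq_bigr => k _; congr scal; last first.
  by congr A; apply: functional_extensionality => i; rewrite ffunE.
by rewrite [RHS](reindex_inj inj_f); apply: eq_bigr => i _; rewrite ffunE.
Qed.

End Form.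

Lemma polynomial_bounded (r : R) : continuous_polynomial m P ->
  exists2 c, 0 <= c & forall x, norm x <= r -> norm (P x) <= c.
Proof.
move=> [[A [hA PA]] cP].
have : locally (zero : X) (fun x => norm (P x) < norm (P zero) + 1).
  have L := filterlim_comp _ _ _ _ _ _ _ _ (cP zero) (filterlim_norm (P zero)).
  apply: (L (fun y => y < norm (P zero) + 1)); apply: open_lt; lra.
move=> /locally_norm_le_locally[d hd].
have r0 := Rabs_pos r; have d0 := cond_pos d.
pose s := d / (2 * (Rabs r + 1)).
have s0 : 0 < s by apply: Rdiv_lt_0_compat; lra.
have [c c0 hc] := polynomial_scal_bound hA PA (emb K (/ s)).
have n0 := norm_ge_0 (P zero).
exists (c * (norm (P zero) + 1)); first nra.
move=> x xr.
have -> : x = scal (emb K (/ s)) (scal (emb K s) x).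
  by rewrite scal_assoc -embM Rinv_l ?emb1 ?scal_one //; lra.
apply: Rle_trans (hc _) _; apply: Rmult_le_compat_l => //; apply/Rlt_le/hd.
rewrite /ball_norm minus_zero_r.
apply: Rle_lt_trans (norm_scal _ _) _; rewrite abs_emb Rabs_pos_eq; last lra.
apply: Rle_lt_trans (_ : s * (Rabs r + 1) < _).
  by apply: Rmult_le_compat_l; have := Rle_abs r; lra.
have -> : s * (Rabs r + 1) = d / 2 by rewrite /s; field; lra.
by lra.
Qed.

(** A continuous polynomial has an expansion with uniformly bounded
    coefficients along any finite family of the unit ball: the coefficients
    are those of the symmetrized multilinear form, which polarization
    controls. *)
Lemma bounded_coefficients : continuous_polynomial m P ->
  exists2 C, 0 < C & forall (I : finType) (e : I -> X),
    (forall k, norm (e k) <= 1) ->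
    exists2 b : {ffun 'I_m -> I} -> Y, forall k, norm (b k) <= C &
      forall c : I -> K, P (\big[plus/zero]_k scal (c k) (e k)) =
        \big[plus/zero]_(k : {ffun 'I_m -> I}) scal (\big[mult/one]_i c (k i))
          (b k).
Proof.
move=> hP; have [[A [hA PA]] _] := hP.
(* Polarization at vectors of the unit ball evaluates [P] in the ball of
   radius [m]; [N] is the number of permutations. *)
pose M := \big[Rplus/0]_(i < m) 1.
have [c c0 hc] := polynomial_bounded M hP.
pose D := \big[Rplus/0]_(S : {ffun 'I_m -> bool}) c.
have D0 : 0 <= D by rewrite /D; elim/big_rec: _ => [|S r _ r0]; lra.
pose N := \big[Rplus/0]_(f : {ffun 'I_m -> 'I_m} | injectiveb f) 1.
have N0 : 0 < N.
  rewrite /N (bigD1 [ffun i => i]) /=; last by apply/injectiveP => i j;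
    rewrite !ffunE.
  by elim/big_rec: _ => [|f r _ r0]; lra.
exists (/ N * D + 1).
  by have := Rmult_le_pos _ _ (Rlt_le _ _ (Rinv_0_lt_compat _ N0)) D0; lra.
move=> I e e1.
pose s (k : {ffun 'I_m -> I}) :=
  \big[plus/zero]_(f : {ffun 'I_m -> 'I_m} | injectiveb f) A
    (fun i => e (k (f i))).
exists (fun k => scal (emb K (/ N)) (s k)) => [k|a].
  apply: Rle_trans (norm_scal _ _) _.
  rewrite abs_emb Rabs_pos_eq; last exact/Rlt_le/Rinv_0_lt_compat.
  suff : norm (s k) <= D.
    by move=> h; have := Rmult_le_compat_l _ _ _
      (Rlt_le _ _ (Rinv_0_lt_compat _ N0)) h; lra.
  rewrite /s -(polarization hA PA (fun i => e (k i))).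
  apply: norm_sum_le => S; apply: Rle_trans (norm_scal _ _) _.
  have h1 : abs (\big[mult/one]_k sgn (S k)) <= 1.
    apply: Rle_trans (abs_prod_le (b := fun=> 1) _) _; first by move=> i;
      rewrite abs_sgn; lra.
    by rewrite big1 //; lra.
  have h2 : norm (P (\big[plus/zero]_i scal (ind (S i)) (e (k i)))) <= c.
    apply: hc; apply: norm_sum_le => i; apply: Rle_trans (norm_scal _ _) _.
    rewrite -(Rmult_1_l 1); apply: Rmult_le_compat; try exact: norm_ge_0;
      try exact: abs_ge_0.
      exact: abs_ind_le.
    exact: e1.
  rewrite -(Rmult_1_l c); apply: Rmult_le_compat => //;
    [exact: abs_ge_0|exact: norm_ge_0].
set x := \big[plus/zero]_k _.
transitivity (scal (emb K (/ N)) (scal (emb K N) (P x))).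
  by rewrite scal_assoc -embM Rinv_l ?emb1 ?scal_one //; lra.
rewrite /N (big_morph (emb K) (@embD K) (@emb0 K)) scal_suml.
under [in RHS]eq_bigr do rewrite scal_assoc scalar_multC -scal_assoc /s
  scal_sumr.
rewrite -[RHS]scal_sumr; congr scal; rewrite exchange_big;
  apply: eq_bigr => f /injectiveP inj_f.
by rewrite emb1 scal_one; apply: polynomial_reindex.
Qed.

End Polarization.

(** * The sequence spaces [l_1] and [l_2] *)

Section Series.
Variable a : nat -> R.
Hypothesis a0 : forall n, 0 <= a n.

Lemma is_lim_partial_sum : ex_series a ->
  is_lim_seq (fun n => \big[Rplus/0]_(i < n) a i) (Series a).
Proof.
move=> /Series_correct h; apply/is_lim_seq_incr_1.
by apply: (is_lim_seq_ext (sum_n a) _ (Series a) _ h) => n; apply: sum_n_big.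
Qed.

Lemma partial_sum_le n : ex_series a -> \big[Rplus/0]_(i < n) a i <= Series a.
Proof.
move=> /is_lim_partial_sum h.
apply: (is_lim_seq_incr_compare _ _ h) => k.
by rewrite big_ord_recr /=; have := a0 k; lra.
Qed.

Lemma Series_le_bound b : ex_series a ->
  (forall n, \big[Rplus/0]_(i < n) a i <= b) -> Series a <= b.
Proof.
move=> /is_lim_partial_sum h hb.
exact: (is_lim_seq_le _ (fun=> b) _ _ hb h (is_lim_seq_const b)).
Qed.

End Series.

Lemma ex_series_finite (a : nat -> R) (N : nat) :
  (forall n : nat, (N <= n)%nat -> a n = 0) -> ex_series a.
Proof.
move=> aN; apply/(ex_series_incr_n a N).
exists 0; apply: (is_series_ext (fun=> zero)).
  by move=> n; rewrite aN // leq_addr.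
rewrite /is_series; apply: (filterlim_ext (fun=> zero));
  last exact: filterlim_const.
by move=> n; rewrite /sum_n sum_n_m_const_zero.
Qed.

Lemma rpow1 x : 0 <= x -> rpow x 1 = x.
Proof.
move=> x0; case: (Req_dec x 0) => [->|xn]; first by rewrite rpow_npos //; lra.
by rewrite rpow_pos ?Rpower_1; lra.
Qed.

Lemma rpow2 x : 0 <= x -> rpow x 2 = x * x.
Proof.
move=> x0; case: (Req_dec x 0) => [->|xn]; first by rewrite rpow_npos; lra.
rewrite rpow_pos; last lra.
by rewrite -[2]/(INR 2) Rpower_pow /=; lra.
Qed.

Lemma rpow_half x : 0 <= x -> rpow x (/ 2) = sqrt x.
Proof.
move=> x0; case: (Req_dec x 0) => [->|xn]; first by rewrite rpow_npos ?sqrt_0;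
  lra.
by rewrite rpow_pos ?Rpower_sqrt; lra.
Qed.

Section SequenceSpaces.
Variable K : AbsRing.

Lemma l1_ex_series (x : l1 K) : ex_series (fun n => abs (x n)).
Proof.
by apply: ex_series_ext (lp_summable x) => n; rewrite rpow1 //; apply: abs_ge_0.
Qed.

Lemma l1_norm (x : l1 K) : norm x = Series (fun n => abs (x n)).
Proof.
rewrite /norm /= /lp_norm Rinv_1 rpow1; last exact: lp_Series_ge0.
by apply: Series_ext => n; rewrite rpow1 //; apply: abs_ge_0.
Qed.

Lemma l1_partial_sum_le (x : l1 K) n :
  \big[Rplus/0]_(i < n) abs (x i) <= norm x.
Proof.
rewrite l1_norm; apply: (partial_sum_le (a := fun n => abs (x n))) => [k|];
  first exact: abs_ge_0.
exact: l1_ex_series.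
Qed.

Lemma l1_coord_le (x : l1 K) n : abs (x n) <= norm x.
Proof.
apply: Rle_trans (l1_partial_sum_le x n.+1); rewrite big_ord_recr /=.
rewrite -{1}(Rplus_0_l (abs (x n))); apply: Rplus_le_compat_r.
by apply: Rsum_ge0 => i; apply: abs_ge_0.
Qed.

Lemma l1_coord_continuous n (x : l1 K) :
  continuous (fun y : l1 K => y n : AbsRing_NormedModule K) x.
Proof.
apply/filterlim_locally => eps; apply: locally_le_locally_norm.
exists eps => y; rewrite /ball_norm => h.
exact: Rle_lt_trans (l1_coord_le (minus y x) n) h.
Qed.

Lemma l1_basis_summable n :
  ex_series (fun j => rpow (abs (if j == n then one else zero : K)) 1).
Proof.
apply: (@ex_series_finite _ n.+1) => j hj.
by rewrite gtn_eqF // abs_zero rpow_npos //; lra.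
Qed.

(** The unit vectors of [l_1]. *)
Definition l1_basis n : l1 K := Lp (l1_basis_summable n).

Lemma l1_basis_norm n : norm (l1_basis n) <= 1.
Proof.
rewrite l1_norm; apply: Series_le_bound => [|N]; first exact: l1_ex_series.
rewrite (eq_bigr (fun j : 'I_N => if j == n :> nat then 1 else 0)); last first.
  by move=> j _ /=; case: eqP; rewrite ?abs_one ?abs_zero.
rewrite -big_mkcond; case: (ltnP n N) => h.
  by rewrite (big_pred1 (Ordinal h)) //; lra.
by rewrite big_pred0 => [|j];
  [lra | rewrite ltn_eqF // (leq_trans (ltn_ord j))].
Qed.

(** Truncation of a sequence to its first [N] coordinates. *)
Definition l1_trunc N (x : l1 K) : l1 K :=
  \big[plus/zero]_(k < N) scal (x k) (l1_basis k).

Lemma l1_truncE N (x : l1 K) n :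
  l1_trunc N x n = if (n < N)%nat then x n else zero.
Proof.
rewrite /l1_trunc (big_morph (fun y : l1 K => y n) (id1 := zero) (op1 := plus))
  //.
rewrite (eq_bigr (fun k : 'I_N => if k == n :> nat then x n else zero));
  last first.
  move=> k _; rewrite -[LHS]/(mult (x k) (if n == k then one else zero)) eq_sym.
  by case: eqP => [->|_]; rewrite ?mult_one_r ?mult_zero_r.
rewrite -big_mkcond; case: (ltnP n N) => h;
  first by rewrite (big_pred1 (Ordinal h)).
by rewrite big_pred0 // => j; rewrite ltn_eqF // (leq_trans (ltn_ord j)).
Qed.

Lemma l1_trunc_err N (x : l1 K) :
  norm (minus (l1_trunc N x) x) <= norm x - \big[Rplus/0]_(i < N) abs (x i).
Proof.
pose tr n := if (n < N)%nat then abs (x n) else 0.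
have tr_ex : ex_series tr.
  by apply: (@ex_series_finite _ N) => n h; rewrite /tr ltnNge h.
rewrite !l1_norm.
rewrite (Series_ext _ (fun n => abs (x n) - tr n)); last first.
  move=> n; change (abs (plus (l1_trunc N x n) (opp (x n))) = abs (x n) - tr n).
  rewrite l1_truncE /tr.
  by case: ltnP => _; rewrite ?plus_opp_r ?abs_zero ?plus_zero_l ?abs_opp; lra.
rewrite Series_minus //; last exact: l1_ex_series.
suff : \big[Rplus/0]_(i < N) abs (x i) <= Series tr by lra.
have -> : \big[Rplus/0]_(i < N) abs (x i) = \big[Rplus/0]_(i < N) tr i.
  by apply: eq_bigr => i _; rewrite /tr ltn_ord.
apply: partial_sum_le => // n; rewrite /tr; case: ifP => _; last lra.
exact: abs_ge_0.
Qed.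

Lemma l1_trunc_lim (x : l1 K) :
  filterlim (fun N => l1_trunc N x) eventually (locally x).
Proof.
apply/filterlim_locally_ball_norm => eps.
have /is_lim_seq_spec/(_ eps) := is_lim_partial_sum (l1_ex_series x).
apply: filter_imp => N; rewrite /ball_norm -l1_norm => h.
apply: Rle_lt_trans (l1_trunc_err N x) _.
by have [_ h2] := Rabs_def2 _ _ h; lra.
Qed.

Lemma l2_ex_series (v : l2 K) : ex_series (fun n => abs (v n) * abs (v n)).
Proof.
by apply: ex_series_ext (lp_summable v) => n; rewrite rpow2 //; apply: abs_ge_0.
Qed.

Lemma l2_norm (v : l2 K) :
  norm v = sqrt (Series (fun n => abs (v n) * abs (v n))).
Proof.
rewrite /norm /= /lp_norm rpow_half; last exact: lp_Series_ge0.
by congr sqrt; apply: Series_ext => n; rewrite rpow2 //; apply: abs_ge_0.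
Qed.

Lemma l2_Series_ge0 (v : l2 K) : 0 <= Series (fun n => abs (v n) * abs (v n)).
Proof.
rewrite -(Series_ext (fun n => rpow (abs (v n)) 2)); first exact: lp_Series_ge0.
by move=> n; rewrite rpow2 //; apply: abs_ge_0.
Qed.

Lemma l2_partial_sum_le (v : l2 K) n :
  \big[Rplus/0]_(i < n) (abs (v i) * abs (v i)) <= norm v * norm v.
Proof.
rewrite l2_norm sqrt_sqrt; last exact: l2_Series_ge0.
apply: (partial_sum_le (a := fun n => abs (v n) * abs (v n)));
  last exact: l2_ex_series.
by move=> k; have := abs_ge_0 (v k); nra.
Qed.

Lemma l2_norm_lim (v : l2 K) :
  is_lim_seq (fun D => sqrt (\big[Rplus/0]_(d < D) (abs (v d) * abs (v d))))
    (norm v).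
Proof.
rewrite l2_norm; apply: is_lim_seq_continuous;
  last exact/is_lim_partial_sum/l2_ex_series.
exact/continuity_pt_sqrt/l2_Series_ge0.
Qed.

End SequenceSpaces.

(** * Grothendieck's theorem for [l_2]-valued sums *)

(** [grothendieck_summing] for the real numbers, stated with their native
    operations. *)
Lemma grothendieck_summing_R (I J : finType) (a : J -> I -> R)
    (B c : R) (n : nat)    (u : I -> 'I_n -> R) :
  (forall t : I -> R, (forall k, Rabs (t k) <= 1) ->
     \big[Rplus/0]_j Rabs (\big[Rplus/0]_k (a j k * t k)) <= B) ->
  0 < c -> (forall k, \big[Rplus/0]_d (u k d * u k d) <= c * c) ->
  \big[Rplus/0]_j sqrt (\big[Rplus/0]_d
     ((\big[Rplus/0]_k (a j k * u k d)) * (\big[Rplus/0]_k (a j k * u k d))))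
       <= 8 * B * c.
Proof.
move=> aB c0 hu.
have /RleP := @grothendieck_summing R I J a B c n u
  (fun t t1 => introT RleP (aB t (fun k => elimT RleP (t1 k))))
  (introT RltP c0) (fun k => introT RleP (hu k)).
rewrite (eq_bigr _ (fun j _ => esym (RsqrtE _))).
have e8 : INR 8 = 8 by rewrite /=; lra.
by rewrite -(INRE 8) e8.
Qed.

Section Scalars.
Variable K : scalars.

Lemma l2_partial_norm_le (v : l2 K) D :
  \big[Rplus/0]_(d < D) (re (v d : K) * re (v d : K)) <= norm v * norm v /\
  \big[Rplus/0]_(d < D) (im (v d : K) * im (v d : K)) <= norm v * norm v.
Proof.
by split; apply: Rle_trans (l2_partial_sum_le v D); apply: Rsum_le => d;
   rewrite sqr_abs; nra.
Qed.

(** Collects the four real contributions to the norm of a vector whose square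
    is bounded through [(x + y)^2 <= 2 x^2 + 2 y^2]. *)
Lemma sqrt_le_add4 s p q r t : 0 <= p -> 0 <= q -> 0 <= r -> 0 <= t ->
  s <= 2 * (p + q + (r + t)) ->
  sqrt s <= 2 * (sqrt p + sqrt q + (sqrt r + sqrt t)).
Proof.
move=> p0 q0 r0 t0 h.
have sp := sqrt_pos p; have sq := sqrt_pos q; have sr := sqrt_pos r;
  have st := sqrt_pos t.
rewrite -(sqrt_square (2 * _)); last lra.
apply: sqrt_le_1_alt; apply: Rle_trans h _.
rewrite -{1}(sqrt_sqrt p p0) -{1}(sqrt_sqrt q q0) -{1}(sqrt_sqrt r r0)
  -{1}(sqrt_sqrt t t0).
set x := sqrt p in sp *; set y := sqrt q in sq *; set z := sqrt r in sr *;
  set w := sqrt t in st *.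
have := Rmult_le_pos _ _ sp sq; have := Rmult_le_pos _ _ sp sr;
  have := Rmult_le_pos _ _ sp st.
have := Rmult_le_pos _ _ sq sr; have := Rmult_le_pos _ _ sq st;
  have := Rmult_le_pos _ _ sr st.
by nra.
Qed.

(** Grothendieck's theorem over the scalars [K]: split the coefficients and
    the vectors into real and imaginary parts. *)
Lemma grothendieck_l2 (I J : finType) (a : J -> I -> K) 
    (b : I -> l2 K) (B c : R) :
  (forall t : I -> R, (forall k, Rabs (t k) <= 1) ->
     \big[Rplus/0]_j abs (\big[plus/zero]_k mult (a j k) (emb K (t k))) <= B) ->
  0 < c -> (forall k, norm (b k) <= c) ->
  \big[Rplus/0]_j norm (\big[plus/zero]_k scal (a j k) (b k)) <= 64 * B * c.
Proof.
move=> aB c0 hb.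
pose v j : l2 K := \big[plus/zero]_k scal (a j k) (b k).
have re_aB t : (forall k, Rabs (t k) <= 1) ->
    \big[Rplus/0]_j Rabs (\big[Rplus/0]_k (re (a j k) * t k)) <= B.
  move=> t1; apply: Rle_trans (aB t t1); apply: Rsum_le => j.
  apply: Rle_trans (abs_re_le _); right; rewrite re_sum; congr Rabs.
  by apply: eq_bigr => k _; rewrite reM re_emb im_emb; ring.
have im_aB t : (forall k, Rabs (t k) <= 1) ->
    \big[Rplus/0]_j Rabs (\big[Rplus/0]_k (im (a j k) * t k)) <= B.
  move=> t1; apply: Rle_trans (aB t t1); apply: Rsum_le => j.
  apply: Rle_trans (abs_im_le _); right; rewrite im_sum; congr Rabs.
  by apply: eq_bigr => k _; rewrite imM re_emb im_emb; ring.
(* Only finitely many coordinates at a time: the norms are limits of those of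
   the first [D] coordinates. *)
have lim : is_lim_seq
    (fun D => \big[Rplus/0]_j sqrt
      (\big[Rplus/0]_(d < D) (abs (v j d) * abs (v j d))))
    (\big[Rplus/0]_j norm (v j)).
  apply: (@filterlim_sum _ R_NormedModule _ _ eventually _ _
           (fun j D => sqrt (\big[Rplus/0]_(d < D)
             (abs (v j d) * abs (v j d))))) => j.
  exact: l2_norm_lim.
refine (is_lim_seq_le _ (fun=> 64 * B * c) _ _ _ lim (is_lim_seq_const _)) => D.
have cc k : norm (b k) * norm (b k) <= c * c.
  by have := hb k; have := norm_ge_0 (b k); nra.
have re_b k : \big[Rplus/0]_(d < D) (re (b k d : K) * re (b k d : K)) <= c * c.
  by have [h _] := l2_partial_norm_le (b k) D; apply: Rle_trans h (cc k).
have im_b k : \big[Rplus/0]_(d < D) (im (b k d : K) * im (b k d : K)) <= c * c.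
  by have [_ h] := l2_partial_norm_le (b k) D; apply: Rle_trans h (cc k).
have hrr := grothendieck_summing_R re_aB c0 re_b.
have hri := grothendieck_summing_R re_aB c0 im_b.
have hir := grothendieck_summing_R im_aB c0 re_b.
have hii := grothendieck_summing_R im_aB c0 im_b.
have -> : 64 * B * c = 2 * ((8 * B * c + 8 * B * c) + (8 * B * c + 8 * B * c))
  by ring.
apply: Rle_trans (Rmult_le_compat_l 2 _ _ _
  (Rplus_le_compat _ _ _ _ (Rplus_le_compat _ _ _ _ hrr hii)
    (Rplus_le_compat _ _ _ _ hri hir)));
  last lra.
rewrite -!big_split -Rsum_scal; apply: Rsum_le => j /=.
have sq0 (F : 'I_D -> R) : 0 <= \big[Rplus/0]_d (F d * F d).
  by apply: Rsum_ge0 => d; nra.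
apply: sqrt_le_add4; [exact: sq0|exact: sq0|exact: sq0|exact: sq0|].
rewrite -!big_split -Rsum_scal; apply: Rsum_le => d /=.
have -> : v j d = \big[plus/zero]_k mult (a j k) (b k d : K).
  by rewrite /v (big_morph (fun y : l2 K => y d : K) (id1 := zero)
    (op1 := plus)).
rewrite sqr_abs re_sum im_sum.
have -> : \big[Rplus/0]_k re (mult (a j k) (b k d : K)) =
    \big[Rplus/0]_k (re (a j k) * re (b k d : K)) - \big[Rplus/0]_k
      (im (a j k) * im (b k d : K)).
  have -> (x y : R) : x - y = x + (-1) * y by ring.
  by rewrite -Rsum_scal -big_split; apply: eq_bigr => k _; rewrite reM /=; ring.
have -> : \big[Rplus/0]_k im (mult (a j k) (b k d : K)) =
    \big[Rplus/0]_k (re (a j k) * im (b k d : K)) + \big[Rplus/0]_k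
      (im (a j k) * re (b k d : K)).
  by rewrite -big_split; apply: eq_bigr => k _; rewrite imM.
set p := \big[Rplus/0]_k _; set q := \big[Rplus/0]_k _.
set r := \big[Rplus/0]_k _; set s := \big[Rplus/0]_k _.
by have := Rle_0_sqr (p + q); have := Rle_0_sqr (r - s); rewrite /Rsqr; lra.
Qed.

(** * Test polynomials on [l_1] *)

Section TestPolynomial.
Variables (m N : nat) (t : {ffun 'I_m -> 'I_N} -> R).

(** The polynomial on [l_1] whose coefficient at the multi-index [k] is the
    real number [t k]. *)
Definition test_poly (x : l1 K) : AbsRing_NormedModule K :=
  \big[plus/zero]_(k : {ffun 'I_m -> 'I_N})
     mult (emb K (t k)) (\big[mult/one]_i (x (k i) : K)).

(** The multilinear form with diagonal [test_poly]. *)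
Definition test_form (x : 'I_m -> l1 K) : AbsRing_NormedModule K :=
  \big[plus/zero]_(k : {ffun 'I_m -> 'I_N})
     mult (emb K (t k)) (\big[mult/one]_i (x i (k i) : K)).

Lemma test_form_multilinear : multilinear test_form.
Proof.
move=> x i.
pose r (k : {ffun 'I_m -> 'I_N}) : K :=
  mult (emb K (t k)) (\big[mult/one]_(j | j != i) (x j (k j) : K)).
have E (u : l1 K) : test_form (update x i u) =
      \big[plus/zero]_(k : {ffun 'I_m -> 'I_N}) mult (u (k i) : K) (r k).
  apply: eq_bigr => k _; rewrite (bigD1 i) //= {1}/update eqxx mult_assoc.
  rewrite (scalar_multC (emb K _)) -mult_assoc; congr mult; congr mult.
  by apply: eq_bigr => j /negPf ji; rewrite /update ji.
split=> [u v|c u]; rewrite !E.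
  by rewrite -big_split; apply: eq_bigr => k _; apply: mult_distr_r.
rewrite (big_morph (scal c) (scal_distr_l c) (scal_zero_r c)).
by apply: eq_bigr => k _; rewrite -[RHS]/(mult c (mult (u (k i) : K) (r k)))
  mult_assoc.
Qed.

Lemma test_poly_continuous (x : l1 K) : continuous test_poly x.
Proof.
apply: (@filterlim_sum K (AbsRing_NormedModule K) _ _ (locally x) _ _
  (fun (k : {ffun 'I_m -> 'I_N}) (y : l1 K) =>
     mult (emb K (t k)) (\big[mult/one]_i (y (k i) : K)))) => k.
apply: (@continuous_mult (l1 K) K (fun=> emb K (t k))
  (fun y : l1 K => \big[mult/one]_i (y (k i) : K)));
    first exact: continuous_const.
apply: (continuous_prod (f := fun i (y : l1 K) => y (k i))) => i.
exact: l1_coord_continuous.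
Qed.

Lemma test_poly_continuous_polynomial : continuous_polynomial m test_poly.
Proof.
split; last exact: test_poly_continuous.
by exists test_form; split => //; apply: test_form_multilinear.
Qed.

Lemma test_poly_norm :
  (forall k, Rabs (t k) <= 1) -> Rbar_le (polynomial_norm test_poly) 1.
Proof.
move=> t1; apply: (proj2 (Lub_Rbar_correct _)) => _ [x [x1 ->]] /=.
apply: Rle_trans (_ : \big[Rplus/0]_(k : {ffun 'I_m -> 'I_N}) \big[Rmult/1]_i
  abs (x (k i)) <= 1).
  apply: (@norm_sum_le K (AbsRing_NormedModule K)) => k.
  have h := @abs_prod_le K _ (fun i : 'I_m => x (k i)) _ (fun i => Rle_refl _).
  apply: Rle_trans (abs_mult _ _) _.
  rewrite abs_emb -[X in _ <= X]Rmult_1_l.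
  by apply: Rmult_le_compat h => //; [exact: Rabs_pos|exact: abs_ge_0].
(* The sum over all multi-indices is the [m]-th power of [sum_k |x_k|]. *)
rewrite -(bigA_distr_bigA (fun (i : 'I_m) (k : 'I_N) => abs (x k))).
have s1 := Rle_trans _ _ _ (l1_partial_sum_le x N) x1.
have s0 : 0 <= \big[Rplus/0]_(k < N) abs (x k) by apply: Rsum_ge0 => k;
  apply: abs_ge_0.
move: s0 s1; move: (\big[Rplus/0]_(k < N) _) => s s0 s1.
suff [] : 0 <= \big[Rmult/1]_(i < m) s <= 1 by [].
by elim/big_rec: _ => [|i r _ [r0 r1]]; [lra | nra].
Qed.

End TestPolynomial.

(** * Factorable strong summability *)

(** The constant is [64] times the bound on the coefficients of [P]. *)
Lemma factorable_of_continuous (m : nat) (P : l1 K -> l2 K) :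
  continuous_polynomial m P -> factorable_strongly_summing 1 m P.
Proof.
move=> hP; split=> //.
have [c c0 hc] := bounded_coefficients hP.
exists (64 * c); split=> [|m1 m2 lam x _ _]; first lra.
set lhs := rpow _ _.
have -> : lhs = \big[Rplus/0]_(j < m1)
    norm (\big[plus/zero]_(i < m2) scal (lam j.+1 i.+1) (P (x j.+1 i.+1))).
  rewrite /lhs sum_n_m_big (_ : 1 / 1 = 1); last lra.
  rewrite rpow1; last by apply: Rsum_ge0 => j; apply: rpow_ge0.
  by apply: eq_bigr => j _; rewrite sum_n_m_big rpow1 //; apply: norm_ge_0.
move=> {lhs}.
have test_le N (t : {ffun 'I_m -> 'I_N} -> R) : (forall k, Rabs (t k) <= 1) ->
    Rbar_le (\big[Rplus/0]_(j < m1)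
      abs (\big[plus/zero]_(i < m2) mult (lam j.+1 i.+1)
        (test_poly t (x j.+1 i.+1))))
      (weak_sum 1 m m1 m2 lam x).
  move=> t1; apply: (proj1 (Lub_Rbar_correct _)); exists (test_poly t).
  split; first exact: test_poly_continuous_polynomial.
  split; first exact: test_poly_norm.
  rewrite sum_n_m_big (_ : 1 / 1 = 1); last lra.
  rewrite rpow1; last by apply: Rsum_ge0 => j; apply: rpow_ge0.
  by apply: eq_bigr => j _; rewrite sum_n_m_big rpow1 //; apply: abs_ge_0.
(* The weak sum is not [-oo], since the zero test polynomial is admissible; if
   it is [+oo], so is its product with the positive constant. *)
case: (weak_sum _ _ _ _ _ _) test_le => [W||] test_le; last first.
- by case: (test_le 0%nat (fun=> 0)) => k; rewrite Rabs_R0; lra.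
- rewrite /Rbar_mult /Rbar_mult'; case: Rle_dec => [h|]; last lra.
  by case: Rle_lt_or_eq_dec => // h0; lra.
have lim : is_lim_seq
   (fun N => \big[Rplus/0]_(j < m1) norm (\big[plus/zero]_(i < m2)
       scal (lam j.+1 i.+1) (P (l1_trunc N (x j.+1 i.+1)))))
   (\big[Rplus/0]_(j < m1) norm (\big[plus/zero]_(i < m2)
       scal (lam j.+1 i.+1) (P (x j.+1 i.+1)))).
  apply: (@filterlim_sum _ R_NormedModule _ _ eventually _ _
    (fun (j : 'I_m1) N => norm (\big[plus/zero]_(i < m2)
       scal (lam j.+1 i.+1) (P (l1_trunc N (x j.+1 i.+1)))))) => j.
  apply: (filterlim_comp _ _ _ _ norm) (filterlim_norm _).
  apply: filterlim_sum => i.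
  apply: (filterlim_comp _ _ _ _ (scal _)) (filterlim_scal_r _ _).
  apply: (filterlim_comp _ _ _ _ P) (proj2 hP _).
  exact: l1_trunc_lim.
refine (is_lim_seq_le _ (fun=> 64 * c * W) _ _ _ lim (is_lim_seq_const _)) => N.
have [b hb Pb] := hc _ (fun k : 'I_N => l1_basis K k)
  (fun k => l1_basis_norm K k).
pose a (j : 'I_m1) (k : {ffun 'I_m -> 'I_N}) : K :=
  \big[plus/zero]_(i < m2) mult (lam j.+1 i.+1)
    (\big[mult/one]_l (x j.+1 i.+1 (k l) : K)).
rewrite (eq_bigr (fun j => norm (\big[plus/zero]_k scal (a j k) (b k))));
  last first.
  move=> j _; congr norm.
  transitivity (\big[plus/zero]_(i < m2)
    \big[plus/zero]_(k : {ffun 'I_m -> 'I_N})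
     scal (mult (lam j.+1 i.+1) (\big[mult/one]_l (x j.+1 i.+1 (k l) : K)))
       (b k)).
    apply: eq_bigr => i _; rewrite /l1_trunc Pb scal_sumr.
    by apply: eq_bigr => k _; rewrite scal_assoc.
  by rewrite exchange_big; apply: eq_bigr => k _; rewrite -scal_suml.
have -> : 64 * c * W = 64 * W * c by ring.
apply: grothendieck_l2 => // t t1.
apply: Rle_trans (test_le N t t1); right; apply: eq_bigr => j _; congr abs.
transitivity (\big[plus/zero]_(k : {ffun 'I_m -> 'I_N}) \big[plus/zero]_(i < m2)
   mult (lam j.+1 i.+1) (mult (emb K (t k))
     (\big[mult/one]_l (x j.+1 i.+1 (k l) : K)))).
  apply: eq_bigr => k _; rewrite /a big_distrl; apply: eq_bigr => i _ /=.
  by rewrite -mult_assoc (scalar_multC (emb K _)).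
by rewrite exchange_big; apply: eq_bigr => i _; rewrite -big_distrr.
Qed.

End Scalars.

Theorem theorem4p9 (K : AbsRing) (hK : K = R_AbsRing \/ K = C_AbsRing)
    (m : nat) (hm : (1 <= m)%nat) (P : l1 K -> l2 K) :
  continuous_polynomial m P <-> factorable_strongly_summing 1 m P.
Proof.
split; last by case.
case: hK => hK; subst K.
  exact: (@factorable_of_continuous real_scalars).
exact: (@factorable_of_continuous complex_scalars).
Qed.
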